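(* Let $n$ be a nonzero integer and let $A_{2n}(L,M)$ be the A-polynomial of the twist knot $T_{2n}$. The edge polynomials corresponding to the edges of nonzero slope of the Newton polygon of $A_{2n}$ are as follows. When $n>0$, the edge polynomials are $$\begin{cases}\pm(t-1) & \text{if the slope is } -4n,\\ -(t-1)^n & \text{if the slope is } 4 \text{ and } n \text{ is even},\\ \pm(t-1)^n & \text{if the slope is } 4 \text{ and } n \text{ is odd}.\end{cases}$$ When $n<0$, the edge polynomials are $$\begin{cases} t+1 & \text{if the slope is } -4n+2,\\ \pm(t-1)^{-n-1} & \text{if the slope is } 4 \text{ and } n \text{ is even},\\ (t-1)^{-n-1} & \text{if the slope is } 4 \text{ and } n \text{ is odd}.\end{cases}$$ Here $\pm$ means that the two parallel edges of the given slope have edge polynomials with the two opposite signs.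
   Context: $T_m$ is the twist knot having a regular planar projection with 2 left-handed vertical crossings (the clasp) and $m$ right-handed horizontal crossings (the twist region; negative $m$ means crossings of the opposite handedness); $T_{2n}$ is the two-bridge knot of slope $2/(4n+1)$, with group $\langle s,t\mid swt^{-1}w^{-1}=1\rangle$, $w=(ts^{-1}t^{-1}s)^n$, $s,t$ meridians. The A-polynomial $A_{2n}(L,M)$ is the polynomial defining the closure of the set of pairs $(L,M)$ of eigenvalues, for a common eigenvector, of the canonical longitude and the meridian under nonabelian representations of the knot group into $SL(2,\mathbb C)$ (the factor $L-1$ from abelian representations is not included). Its sign is normalized so that $$A_{2n}=-M^{2n}(1+LM^2)^{2n}\sum_{i=0}^{2n}\binom{n+\lfloor i/2\rfloor}{i}(1-M^2)^i(1+LM^2)^{-i}(L-1)^{\lfloor i/2\rfloor}(LM^2-M^{-2})^{\lfloor (1+i)/2\rfloor}\quad (n\ge0),$$ $$A_{2n}=M^{-2n}(1+LM^2)^{-2n-1}\sum_{i=0}^{-2n-1}\binom{-n+\lfloor (i-1)/2\rfloor}{i}(M^2-1)^i(1+LM^2)^{-i}(L-1)^{\lfloor i/2\rfloor}(LM^2-M^{-2})^{\lfloor (1+i)/2\rfloor}\quad (n<0).$$ The Newton polygon of $A_{2n}$ is the convex hull in the plane of the points $(b,a)$ for which $L^bM^a$ has nonzero coefficient in $A_{2n}$; an edge with direction vector $(b,a)$ has slope $a/b$ (in lowest terms). The edge polynomial $f_{a/b}(t)$ of an edge of slope $a/b$ is obtained from the sum of the terms of $A_{2n}$ lying on that edge by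 dividing by the monomial (without its coefficient) at an end of the edge and substituting $t$ for $L^bM^a$ (up to replacing $L^bM^a$ by its inverse, so as to obtain a polynomial with nonzero constant term). Assertions about a slope refer only to edges of that slope that occur (for $n=-1$, $A_{-2}=1+LM^6$ has only slope $6$). *)

(* Defs.v *)
From mathcomp Require Import all_boot all_order all_algebra.
From mathcomp Require Import reals complex.

Set Implicit Arguments.
Unset Strict Implicit.
Unset Printing Implicit Defensive.

Import Order.TTheory GRing.Theory Num.Theory.

Local Open Scope ring_scope.

Section Representations.
Variable K : fieldType.
Implicit Types S T : 'M[K]_2.

(* The words w = (t s^-1 t^-1 s)^n and w~ = (s t^-1 s^-1 t)^n (w written
   backwards) at s = S, t = T. *)
Definition twist_word (n : int) S T : 'M[K]_2 :=
  (T * S^-1 * T^-1 * S) ^ n.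

Definition twist_word_rev (n : int) S T : 'M[K]_2 :=
  (S * T^-1 * S^-1 * T) ^ n.

(* The canonical longitude w w~: both w and w~ have exponent sum 0, and
   s w = w t implies t w~ = w~ s, so that w w~ commutes with the meridian s.
   For n = -1 (trefoil) it is z s^-6 with z = (sts)^2 central, so L M^6 = -1
   on nonabelian representations, in accordance with A_{-2} = 1 + L M^6. *)
Definition longitude (n : int) S T : 'M[K]_2 :=
  twist_word n S T * twist_word_rev n S T.

(* (S, T) are the images of (s, t) under a nonabelian representation of
   < s, t | s w t^-1 w^-1 = 1 > into SL(2, K). *)
Definition nonabelian_rep (n : int) S T : Prop :=
  [/\ \det S = 1, \det T = 1,
      S * twist_word n S T * T^-1 * (twist_word n S T)^-1 = 1
    & S * T <> T * S].

Definition eigenvalue_pair (n : int) (L M : K) : Prop :=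
  exists S T (v : 'cV[K]_2),
    [/\ nonabelian_rep n S T, v != 0, longitude n S T *m v = L *: v
      & S *m v = M *: v].

End Representations.

(* A polynomial in L and M is an element of {poly {poly Z}}: L is the outer
   variable and M the inner one, so A`_b`_a is the coefficient of L^b M^a. *)
Definition eval2 (Z : comNzRingType) (P : {poly {poly Z}}) (L M : Z) : Z :=
  P.[L%:P].[M].

(* The ideal of the polynomials over K vanishing on the Zariski closure of the
   set of eigenvalue pairs (equivalently, on that set) is generated by A. *)
Definition defines_eigenvalue_closure (K : fieldType) (n : int)
    (A : {poly {poly int}}) : Prop :=
  forall P : {poly {poly K}},
    (forall L M, eigenvalue_pair n L M -> eval2 P L M = 0) <->
    (exists Q, P = Q * map_poly (map_poly intr) A).

(* For n = - m < 0, floor((i - 1) / 2) - n is the natural number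
   (m + uphalf i).-1. *)
Definition A_expr (K : fieldType) (n : int) (L M : K) : K :=
  match n with
  | Posz m =>
      - M ^+ (2 * m) * (1 + L * M ^+ 2) ^+ (2 * m) *
      \sum_(0 <= i < (2 * m).+1)
        'C(m + i./2, i)%:R * (1 - M ^+ 2) ^+ i * (1 + L * M ^+ 2) ^- i *
        (L - 1) ^+ i./2 * (L * M ^+ 2 - M ^- 2) ^+ uphalf i
  | Negz m' => let m := m'.+1 in
      M ^+ (2 * m) * (1 + L * M ^+ 2) ^+ (2 * m).-1 *
      \sum_(0 <= i < 2 * m)
        'C((m + uphalf i).-1, i)%:R * (M ^+ 2 - 1) ^+ i *
        (1 + L * M ^+ 2) ^- i *
        (L - 1) ^+ i./2 * (L * M ^+ 2 - M ^- 2) ^+ uphalf i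
  end.

Definition A_normalized (n : int) (A : {poly {poly int}}) : Prop :=
  tofrac A = A_expr n (tofrac 'X) (tofrac ('X%:P)).

(* The first condition determines A up to a nonzero scalar, which is fixed by
   the second one. *)
Definition is_A_polynomial (R : realType) (n : int) (A : {poly {poly int}}) :
    Prop :=
  defines_eigenvalue_closure R[i] n A /\ A_normalized n A.

(* The lattice point (b, a) : int * int stands for L^b M^a. *)
Definition coef2 (A : {poly {poly int}}) (x : int * int) : int :=
  match x with
  | (Posz b, Posz a) => A`_b`_a
  | _ => 0
  end.

Definition toplane (R : realType) (x : int * int) : R * R :=
  (x.1%:~R, x.2%:~R).

Definition Newton_polygon (R : realType) (A : {poly {poly int}}) (x : R * R) :
    Prop :=
  exists (m : nat) (s : 'I_m -> int * int) (w : 'I_m -> R),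
    [/\ forall i, coef2 A (s i) != 0, forall i, 0 <= w i,
        \sum_i w i = 1 & x = \sum_i w i *: (toplane R (s i) : R^o * R^o)].

Definition segment (R : realType) (p q x : R * R) : Prop :=
  exists2 t : R, 0 <= t <= 1 &
    x = (1 - t) *: (p : R^o * R^o) + t *: (q : R^o * R^o).

(* An edge is recorded by its endpoints (p, q) in lexicographic order, that is,
   from left to right, or upwards if it is vertical. *)
Definition left_of (p q : int * int) : Prop :=
  p.1 < q.1 \/ p.1 = q.1 /\ p.2 < q.2.

(* The edges are the one-dimensional faces; a polygon which degenerates to a
   segment has a single edge. All vertices are lattice points. *)
Definition is_edge (R : realType) (A : {poly {poly int}})
    (e : (int * int) * (int * int)) : Prop :=
  left_of e.1 e.2 /\
  exists u v c : R,
    [/\ (u, v) <> (0, 0),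
        forall x, Newton_polygon A x -> u * x.1 + v * x.2 <= c
      & forall x, Newton_polygon A x /\ u * x.1 + v * x.2 = c <->
                  segment (toplane R e.1) (toplane R e.2) x].

Definition edge_length (e : (int * int) * (int * int)) : nat :=
  `|gcdz (e.2.1 - e.1.1) (e.2.2 - e.1.2)|%N.

(* The primitive direction (b, a) of the edge; it has b > 0 unless the edge is
   vertical, in which case it is (0, 1). *)
Definition edge_dir (e : (int * int) * (int * int)) : int * int :=
  (((e.2.1 - e.1.1) %/ edge_length e)%Z, ((e.2.2 - e.1.2) %/ edge_length e)%Z).

(* Slope a in lowest terms is a / 1; a vertical edge has no integral slope and
   in particular does not have slope 0. *)
Definition has_slope (e : (int * int) * (int * int)) (a : int) : Prop :=
  edge_dir e = (1, a).

(* The terms on the edge, divided by the monomial at its left end, with t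
   substituted for L^b M^a, where (b, a) = edge_dir e. *)
Definition edge_poly (A : {poly {poly int}})
    (e : (int * int) * (int * int)) : {poly int} :=
  \poly_(k < (edge_length e).+1) coef2 A (e.1 + edge_dir e *+ k).

Definition edges_have_poly (R : realType) (A : {poly {poly int}}) (a : int)
    (f : {poly int}) : Prop :=
  forall e, is_edge R A e -> has_slope e a -> edge_poly A e = f.

(* The meaning of "+- f": there are exactly two edges of slope a, and their
   edge polynomials (in the same variable t = L M^a) are f and -f. *)
Definition edges_have_opposite_polys (R : realType) (A : {poly {poly int}})
    (a : int) (f : {poly int}) : Prop :=
  exists e1 e2,
    [/\ e1 <> e2,
        forall e, is_edge R A e /\ has_slope e a <-> e = e1 \/ e = e2,
        edge_poly A e1 = f
      & edge_poly A e2 = - f].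

(* Main.v *)
Require Import Defs.
From mathcomp Require Import all_boot all_order all_algebra.
From mathcomp Require Import reals complex.
From mathcomp Require Import ring lra zify.

Import Order.TTheory GRing.Theory Num.Theory.

Local Open Scope ring_scope.

(* Split into even and odd indices, the sum defining A_{2n} becomes a
   combination of the two components of a linear recursion with polynomial
   coefficients. Leading forms with respect to an integral weight on the
   monomials L^b M^a are multiplicative, so the recursion gives those of A_{2n}
   in the directions (-4, 1), (4, -1), (0, 1), (0, -1), (-1, 0) and (1, 0). No
   two top terms cancel in the first two directions, whence the powers of
   L M^4 - 1; in the last two the recursion sums up to a single monomial. These
   six forms pin down the Newton polygon as a hexagon with pairs of parallel
   sides of slopes 4, 0 and - 4 n (for n > 0) or - 4 n + 2 (for n < 0), which
   degenerates to a parallelogram for n = 1 and to a segment for n = -1. *)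

(** * The A-polynomial as a linear recursion *)

(** The defining sums hide their coefficients behind negative powers of M and of 1 + L M^2.
    Multiplying each recursion step by M^2 (1 + L M^2)^2 leaves a 2 x 2 matrix whose entries are
    sums of products of the five short factors 1 + L M^2, 1 - M^2, L - 1, L M^4 - 1 and M^2, with
    visible leading forms. The sides of slope -4n or -4n + 2 have normals that depend on n, so no
    leading form is computed for them. Instead the two extreme columns, of least and greatest degree
    in L, are found: the combination of components that forms A_{2n} is a left eigenvector of the
    leading matrix, so each column is one monomial. All other monomials lie at least one column
    further in, where the bound from a neighbouring side suffices. Vertically the two components
    have equal weight. For n > 0 their top terms cancel in part and the power of L - 1 drops to n -
    1; for n < 0 the coefficients of the combination break the tie. The upper bounds become
    equalities because every corner is an end of some power of t - 1, with coefficient 1 or -1. *)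

Section TwistPair.
Context {R : comNzRingType}.
Implicit Types (a b g d L M : R).

Definition linear_pair a b g d n : R * R :=
  iter n (fun p => (a * p.1 + b * p.2, g * p.2 + d * p.1)) (1, 0).

(** With y = 1 + L M^2, g = (1 - M^2) / y, kap = L M^2 - M^-2 and q = g^2 (L - 1) kap, this is the
    recursion of [even_sum q n] and [g * kap * odd_sum q n], multiplied at each step by M^2 y^2 to
    clear denominators. *)
Definition twist_pair L M : nat -> R * R :=
  linear_pair
    ((1 + L * M ^+ 2) ^+ 2 * M ^+ 2 +
      (1 - M ^+ 2) ^+ 2 * (L - 1) * (L * M ^+ 4 - 1))
    ((1 - M ^+ 2) * (L - 1) * (1 + L * M ^+ 2) * M ^+ 2)
    ((1 + L * M ^+ 2) ^+ 2 * M ^+ 2)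
    ((1 - M ^+ 2) * (L * M ^+ 4 - 1) * (1 + L * M ^+ 2)).

(** For [Negz m] the odd half of the sum runs one step ahead of the even half. Rewriting it at step
    m produces the coefficients M^2 y = M^2 + L M^4 and M^2 y - (1 - M^2)(L M^4 - 1) = 1 + L M^6,
    where y = 1 + L M^2. *)
Definition twist_poly (n : int) L M : R :=
  match n with
  | Posz m => - ((twist_pair L M m).1 + (twist_pair L M m).2)
  | Negz m =>
      (1 + L * M ^+ 6) * (twist_pair L M m).1 -
      (M ^+ 2 + L * M ^+ 4) * (twist_pair L M m).2
  end.

End TwistPair.

Lemma rmorph_twist_pair (R S : comNzRingType) (f : {rmorphism R -> S}) L M n :
  twist_pair (f L) (f M) n = (f (twist_pair L M n).1, f (twist_pair L M n).2).
Proof.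
elim: n => [|n]; first by rewrite /= rmorph1 rmorph0.
rewrite /twist_pair /linear_pair !iterS => -> /=.
by rewrite !(rmorphN, rmorphD, rmorphM, rmorphXn, rmorph1).
Qed.

Lemma rmorph_twist_poly (R S : comNzRingType) (f : {rmorphism R -> S}) n L M :
  twist_poly n (f L) (f M) = f (twist_poly n L M).
Proof.
case: n => n; rewrite /twist_poly rmorph_twist_pair /=.
all: by rewrite !(rmorphN, rmorphD, rmorphM, rmorphXn, rmorph1).
Qed.

Section BinomialSums.
Context {R : comNzRingType}.
Implicit Type q : R.

(** These are the Morgan-Voyce polynomials b_n(q) and, for [odd_sum], B_{n-1}(q); their mutual
    recursion is Pascal's rule. *)
Definition even_sum q n : R := \sum_(0 <= j < n.+1) 'C(n + j, 2 * j)%:R * q ^+ j.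
Definition odd_sum q n : R :=
  \sum_(0 <= j < n) 'C(n + j, (2 * j).+1)%:R * q ^+ j.

Lemma odd_sumS q n : odd_sum q n.+1 = odd_sum q n + even_sum q n.
Proof.
rewrite /odd_sum /even_sum.
(* The added term j = n has binomial coefficient C(2n, 2n + 1) = 0, so both sums get the same
   range. *)
have -> : \sum_(0 <= j < n) 'C(n + j, (2 * j).+1)%:R * q ^+ j =
          \sum_(0 <= j < n.+1) 'C(n + j, (2 * j).+1)%:R * q ^+ j.
  by rewrite [RHS]big_nat_recr //= bin_small ?mul0r ?addr0 // addnn mul2n.
rewrite -big_split; apply: eq_bigr => j _ /=.
by rewrite addSn binS natrD mulrDl.
Qed.

Lemma even_sumS q n : even_sum q n.+1 = even_sum q n + q * odd_sum q n.+1.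
Proof.
rewrite /odd_sum /even_sum.
have -> : \sum_(0 <= j < n.+1) 'C(n + j, 2 * j)%:R * q ^+ j =
          \sum_(0 <= j < n.+2) 'C(n + j, 2 * j)%:R * q ^+ j.
  by rewrite [RHS]big_nat_recr //= bin_small ?mul0r ?addr0 //; lia.
rewrite big_nat_recl // [in RHS]big_nat_recl // !muln0 !bin0 -addrA; congr (_ + _).
rewrite big_distrr -big_split; apply: eq_bigr => j _ /=.
have -> : (2 * j.+1 = (2 * j).+2)%N by lia.
by rewrite !addnS addSn binS natrD exprS; ring.
Qed.

Lemma sum_even_odd (F : nat -> R) n :
  \sum_(0 <= i < 2 * n) F i =
  \sum_(0 <= j < n) F (2 * j)%N + \sum_(0 <= j < n) F (2 * j).+1.
Proof.
elim: n => [|n IHn]; first by rewrite !big_nil addr0.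
have -> : (2 * n.+1 = (2 * n).+2)%N by lia.
by rewrite !big_nat_recr // IHn /=; ring.
Qed.

End BinomialSums.

Lemma half_2j j : ((2 * j)./2 = j)%N. Proof. lia. Qed.
Lemma half_2jS j : ((2 * j).+1./2 = j)%N. Proof. lia. Qed.
Lemma uphalf_2j j : (uphalf (2 * j) = j)%N. Proof. lia. Qed.
Lemma uphalf_2jS j : (uphalf (2 * j).+1 = j.+1)%N. Proof. lia. Qed.

Lemma twist_pair_sums (K : fieldType) (L M : K) n :
  M != 0 -> 1 + L * M ^+ 2 != 0 ->
  let g := (1 - M ^+ 2) / (1 + L * M ^+ 2) in
  let kap := L * M ^+ 2 - M ^- 2 in
  let q := g ^+ 2 * (L - 1) * kap in
  twist_pair L M n =
    ((M ^+ 2 * (1 + L * M ^+ 2) ^+ 2) ^+ n * even_sum q n,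
     (M ^+ 2 * (1 + L * M ^+ 2) ^+ 2) ^+ n * (g * kap * odd_sum q n)).
Proof.
move=> M0 y0 g kap q; elim: n => [|n IHn].
  by rewrite /even_sum /odd_sum big_nat1 big_nil /=; congr (_, _); rewrite ?bin0; ring.
move: IHn; rewrite /twist_pair /linear_pair iterS => -> /=.
rewrite even_sumS !odd_sumS /q /kap /g !exprS; congr (_, _); field.
all: by rewrite ?M0 ?y0.
Qed.

Lemma A_exprE (K : fieldType) n (L M : K) :
  M != 0 -> 1 + L * M ^+ 2 != 0 -> A_expr n L M = twist_poly n L M.
Proof.
move=> M0 y0.
pose g := (1 - M ^+ 2) / (1 + L * M ^+ 2).
pose kap := L * M ^+ 2 - M ^- 2.
pose q := g ^+ 2 * (L - 1) * kap.
(* [h] is 1 - M^2 for n >= 0 and M^2 - 1 for n < 0: even terms see only its square, odd terms keep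
   its sign. *)
have evP (h : K) (j : nat) : h ^+ 2 = (1 - M ^+ 2) ^+ 2 ->
    h ^+ (2 * j) * (1 + L * M ^+ 2) ^- (2 * j) * (L - 1) ^+ j * kap ^+ j = q ^+ j.
  by move=> h2; rewrite !exprM h2 -!exprVn -!exprMn; congr (_ ^+ _).
have odP (h : K) (j : nat) : h ^+ 2 = (1 - M ^+ 2) ^+ 2 ->
    h ^+ (2 * j).+1 * (1 + L * M ^+ 2) ^- (2 * j).+1 * (L - 1) ^+ j * kap ^+ j.+1
    = h / (1 + L * M ^+ 2) * kap * q ^+ j.
  move=> h2; rewrite -(evP h j h2) !exprS !invfM; ring.
case: n => n.
  rewrite /A_expr /twist_poly twist_pair_sums // -/g -/kap -/q.
  rewrite big_nat_recr //= sum_even_odd.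
  have evF j : 'C(n + (2 * j)./2, 2 * j)%:R * (1 - M ^+ 2) ^+ (2 * j) *
      (1 + L * M ^+ 2) ^- (2 * j) * (L - 1) ^+ (2 * j)./2 *
      (L * M ^+ 2 - M ^- 2) ^+ uphalf (2 * j) = 'C(n + j, 2 * j)%:R * q ^+ j.
    by rewrite half_2j uphalf_2j -/kap -(evP (1 - M ^+ 2)) // -!mulrA.
  have odF j : 'C(n + (2 * j).+1./2, (2 * j).+1)%:R * (1 - M ^+ 2) ^+ (2 * j).+1 *
      (1 + L * M ^+ 2) ^- (2 * j).+1 * (L - 1) ^+ (2 * j).+1./2 *
      (L * M ^+ 2 - M ^- 2) ^+ uphalf (2 * j).+1 =
      g * kap * ('C(n + j, (2 * j).+1)%:R * q ^+ j).
    rewrite half_2jS uphalf_2jS -/kap /g [RHS]mulrCA -(odP (1 - M ^+ 2)) //.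
    by rewrite -!mulrA.
  rewrite (eq_bigr _ (fun j _ => evF j)) (eq_bigr _ (fun j _ => odF j)) evF.
  rewrite -big_distrr /= addrAC.
  rewrite -(big_nat_recr _ _ (fun j => 'C(n + j, 2 * j)%:R * q ^+ j)) //=.
  rewrite -/(even_sum q n) -/(odd_sum q n) [(M ^+ 2 * _) ^+ n]exprMn !exprM; ring.
rewrite /A_expr /twist_poly twist_pair_sums // -/g -/kap -/q.
have -> : ((2 * n.+1).-1 = (2 * n).+1)%N by lia.
rewrite sum_even_odd.
have sqr_sub : (M ^+ 2 - 1) ^+ 2 = (1 - M ^+ 2) ^+ 2 by ring.
have evF j : 'C((n.+1 + uphalf (2 * j)).-1, 2 * j)%:R * (M ^+ 2 - 1) ^+ (2 * j) *
    (1 + L * M ^+ 2) ^- (2 * j) * (L - 1) ^+ (2 * j)./2 *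
    (L * M ^+ 2 - M ^- 2) ^+ uphalf (2 * j) = 'C(n + j, 2 * j)%:R * q ^+ j.
  by rewrite half_2j uphalf_2j -/kap -(evP _ j sqr_sub) -!mulrA.
have odF j : 'C((n.+1 + uphalf (2 * j).+1).-1, (2 * j).+1)%:R *
    (M ^+ 2 - 1) ^+ (2 * j).+1 *
    (1 + L * M ^+ 2) ^- (2 * j).+1 * (L - 1) ^+ (2 * j).+1./2 *
    (L * M ^+ 2 - M ^- 2) ^+ uphalf (2 * j).+1 =
    - (g * kap) * ('C(n.+1 + j, (2 * j).+1)%:R * q ^+ j).
  rewrite half_2jS uphalf_2jS addnS /= -/kap /g -[1 - _ in RHS]opprB.
  have -> : - (- (M ^+ 2 - 1) / (1 + L * M ^+ 2) * kap) =
    (M ^+ 2 - 1) / (1 + L * M ^+ 2) * kap by ring.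
  by rewrite [RHS]mulrCA -(odP _ j sqr_sub) -!mulrA.
rewrite (eq_bigr _ (fun j _ => evF j)) (eq_bigr _ (fun j _ => odF j)).
rewrite -big_distrr /= -/(even_sum q n) -/(odd_sum q n.+1) odd_sumS.
have -> : (2 * n.+1 = (2 * n).+2)%N by lia.
have expS (x : K) : x ^+ (2 * n).+1 = x * x ^+ 2 ^+ n by rewrite exprS exprM.
rewrite [(M ^+ 2 * _) ^+ n]exprMn [M ^+ _.+2]exprS !expS /g /kap; field.
by rewrite M0 y0.
Qed.

Notation polyLM := {poly {poly int}}.

Lemma A_normalizedE n (A : polyLM) :
  A_normalized n A -> A = twist_poly n 'X 'X%:P.
Proof.
rewrite /A_normalized => hA; apply/eqP; rewrite -tofrac_eq; apply/eqP.
have X0 : ('X%:P : polyLM) != 0 by rewrite polyC_eq0 polyX_eq0.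
rewrite hA A_exprE ?rmorph_twist_poly // ?tofrac_eq0 //.
rewrite -tofracXn -tofracM -tofrac1 -tofracD tofrac_eq0.
(* At L = 0 the polynomial 1 + L M^2 becomes 1. *)
apply/eqP => /(congr1 (fun p : polyLM => p.[0])) /eqP.
by rewrite !hornerE /= oner_eq0.
Qed.

(** * Faces of convex sets in the plane *)

Definition dot {Z : pzRingType} (N x : Z * Z) : Z := N.1 * x.1 + N.2 * x.2.
Definition det2 {Z : pzRingType} (N N' : Z * Z) : Z := N.1 * N'.2 - N.2 * N'.1.

Section PlaneConvexity.
Context {R : realType}.
Implicit Types (N w V p q x : R * R) (c : R) (P : R * R -> Prop).

Lemma convex_combE (t : R) p q :
  (1 - t) *: (p : R^o * R^o) + t *: (q : R^o * R^o) =
  ((1 - t) * p.1 + t * q.1, (1 - t) * p.2 + t * q.2).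
Proof. by []. Qed.

Lemma cramer_eq {N1 N2 p q} : det2 N1 N2 != 0 ->
  dot N1 p = dot N1 q -> dot N2 p = dot N2 q -> p = q.
Proof.
case: N1 N2 p q => [a b] [a' b'] [x1 x2] [y1 y2]; rewrite /det2 /dot /= => D h1 h2.
have e1 : (a * b' - b * a') * (x1 - y1) = 0.
  have -> : (a * b' - b * a') * (x1 - y1) = (a * x1 + b * x2) * b' -
    (a' * x1 + b' * x2) * b - (a * y1 + b * y2) * b' + (a' * y1 + b' * y2) * b.
    by ring.
  by rewrite h1 h2; ring.
have e2 : (a * b' - b * a') * (x2 - y2) = 0.
  have -> : (a * b' - b * a') * (x2 - y2) = (a' * x1 + b' * x2) * a -
    (a * x1 + b * x2) * a' - (a' * y1 + b' * y2) * a + (a * y1 + b * y2) * a'.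
    by ring.
  by rewrite h1 h2; ring.
move/eqP: e1; rewrite mulf_eq0 (negPf D) subr_eq0 => /eqP ->.
by move/eqP: e2; rewrite mulf_eq0 (negPf D) subr_eq0 => /eqP ->.
Qed.

(** Cramer's rule for the coordinates of [w] in the basis [N1], [N2], paired with [x]. *)
Lemma det2_dot N1 N2 w x : det2 N1 N2 * dot w x =
  det2 w N2 * dot N1 x + det2 N1 w * dot N2 x.
Proof. rewrite /det2 /dot; ring. Qed.

Section Corner.
Context {P} {N1 N2 V w} {c1 c2 c : R}.
Hypotheses (D : 0 < det2 N1 N2) (PV : P V).
Hypotheses (le1 : forall x, P x -> dot N1 x <= c1) (V1 : dot N1 V = c1).
Hypotheses (le2 : forall x, P x -> dot N2 x <= c2) (V2 : dot N2 V = c2).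
Hypotheses (w1 : 0 <= det2 N1 w) (w2 : 0 <= det2 w N2).
Hypotheses (lew : forall x, P x -> dot w x <= c).

(** By [det2_dot], [w] is a nonnegative combination of [N1] and [N2], both maximal at [V]. A point
    reaching the maximum of [w] can therefore fall short in neither normal that enters with positive
    weight. *)
Lemma corner_face p : P p -> dot w p = c ->
  (0 < det2 w N2 -> dot N1 p = c1) /\ (0 < det2 N1 w -> dot N2 p = c2).
Proof.
move=> Pp wp.
have hp := det2_dot N1 N2 w p; have hV := det2_dot N1 N2 w V.
have := le1 _ Pp; have := le2 _ Pp; have := lew _ PV.
rewrite V1 V2 in hV; rewrite wp in hp => lV l2 l1.
have hc : det2 N1 N2 * dot w V <= det2 N1 N2 * c by rewrite ler_pM2l.
have e1 : 0 <= det2 w N2 * (c1 - dot N1 p) by rewrite mulr_ge0 // subr_ge0.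
have e2 : 0 <= det2 N1 w * (c2 - dot N2 p) by rewrite mulr_ge0 // subr_ge0.
split=> h.
- have /eqP : det2 w N2 * (c1 - dot N1 p) = 0 by lra.
  by rewrite mulf_eq0 gt_eqF //= subr_eq0 => /eqP.
- have /eqP : det2 N1 w * (c2 - dot N2 p) = 0 by lra.
  by rewrite mulf_eq0 gt_eqF //= subr_eq0 => /eqP.
Qed.

(* A normal strictly inside the cone of [N1] and [N2] is maximal at [V] only. *)
Lemma corner_normal p q : P p -> P q -> p <> q -> dot w p = c -> dot w q = c ->
  det2 N1 w = 0 \/ det2 w N2 = 0.
Proof.
move=> Pp Pq pq wp wq.
have [p1 p2] := corner_face _ Pp wp; have [q1 q2] := corner_face _ Pq wq.
move: w1 w2; rewrite !le_eqVlt => /predU1P[<-|h1]; first by left.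
move=> /predU1P[<-|h2]; first by right.
by case: pq; apply: (@cramer_eq N1 N2);
  rewrite ?gt_eqF // ?p1 ?q1 ?p2 ?q2.
Qed.

End Corner.

Lemma parallel_face {P N w V c c1 p} :
  (forall x, P x -> dot N x <= c1) -> P V -> dot N V = c1 ->
  (forall x, P x -> dot w x <= c) -> P p -> dot w p = c ->
  forall r, 0 < r -> w = (r * N.1, r * N.2) ->
  forall x, P x -> dot w x = c <-> dot N x = c1.
Proof.
move=> leN PV VN lew Pp wp r r0 e x Px.
have wE z : dot w z = r * dot N z by rewrite e /dot /=; ring.
have cE : c = r * c1.
  apply/le_anti; rewrite -{1}wp -{2}VN -wE (lew _ PV) andbT wE ler_pM2l //.
  exact: leN.
by rewrite wE cE; split=> [/mulfI|->] //; apply; rewrite gt_eqF.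
Qed.

Lemma det2_eq0_l {N w N'} : det2 N w = 0 -> 0 < det2 N N' ->
  w = (det2 w N' / det2 N N' * N.1, det2 w N' / det2 N N' * N.2).
Proof.
move=> h D; have D0 : det2 N N' != 0 by rewrite gt_eqF.
case: w N N' h D D0 => [a b] [a1 b1] [a2 b2]; rewrite /det2 /= => h D D0.
have e1 : (a1 * b2 - b1 * a2) * a = (a * b2 - b * a2) * a1.
  have -> : (a * b2 - b * a2) * a1 = (a1 * b2 - b1 * a2) * a -
    (a1 * b - b1 * a) * a2 by ring.
  by rewrite h mul0r subr0.
have e2 : (a1 * b2 - b1 * a2) * b = (a * b2 - b * a2) * b1.
  have -> : (a * b2 - b * a2) * b1 = (a1 * b2 - b1 * a2) * b -
    (a1 * b - b1 * a) * b2 by ring.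
  by rewrite h mul0r subr0.
by congr (_, _); apply: (mulfI D0); rewrite ?e1 ?e2; field.
Qed.

Lemma det2C N w : det2 N w = - det2 w N. Proof. rewrite /det2; ring. Qed.

Lemma det2_eq0_r {N w N'} : det2 w N = 0 -> 0 < det2 N' N ->
  w = (det2 N' w / det2 N' N * N.1, det2 N' w / det2 N' N * N.2).
Proof.
move=> h D.
have h' : det2 (- N.1, - N.2) w = 0 by move: h; rewrite /det2 /=; lra.
have D' : 0 < det2 (- N.1, - N.2) N' by move: D; rewrite /det2 /=; lra.
have := det2_eq0_l h' D'.
have -> : det2 (- N.1, - N.2) N' = det2 N' N by rewrite /det2 /=; ring.
by rewrite (det2C w N') /= !mulNr !mulrN !opprK.
Qed.

(** The points of the supporting line are [V] plus multiples of the direction (- N1.2, N1.1). As the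
    normals turn counterclockwise, the bound for [N0] forbids points before [V] and the bound for
    [N2] points beyond [V']. *)
Lemma side_segment P N0 N1 N2 c0 c1 c2 V V' :
  (forall x, P x -> dot N0 x <= c0) -> (forall x, P x -> dot N2 x <= c2) ->
  0 < det2 N0 N1 -> 0 < det2 N1 N2 ->
  dot N0 V = c0 -> dot N1 V = c1 -> dot N1 V' = c1 -> dot N2 V' = c2 ->
  (forall x, segment V V' x -> P x) ->
  forall x, P x /\ dot N1 x = c1 <-> segment V V' x.
Proof.
move=> le0 le2 D01 D12 V0 V1 V1' V2' segP x; split; last first.
  move=> sx; split; first exact: segP.
  case: sx => t _ ->; rewrite -V1 in V1' *.
  have -> : dot N1 ((1 - t) *: (V : R^o * R^o) + t *: (V' : R^o * R^o)) =
    (1 - t) * dot N1 V + t * dot N1 V' by rewrite convex_combE /dot /=; ring.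
  by rewrite V1'; ring.
move=> [Px x1]; have x0 := le0 _ Px; have x2 := le2 _ Px.
pose n2 := N1.1 ^+ 2 + N1.2 ^+ 2.
have n2_gt0 : 0 < n2.
  rewrite lt_def addr_ge0 ?sqr_ge0 // andbT; apply: contraTneq D01 => /eqP.
  rewrite paddr_eq0 ?sqr_ge0 // !sqrf_eq0 => /andP[/eqP e1 /eqP e2].
  by rewrite /det2 e1 e2 !mulr0 subr0 ltxx.
have along p q : dot N1 p = dot N1 q -> exists t,
    q = (p.1 - t * N1.2, p.2 + t * N1.1).
  move=> pq; exists ((N1.1 * (q.2 - p.2) - N1.2 * (q.1 - p.1)) / n2).
  have h : N1.1 * (q.1 - p.1) = - (N1.2 * (q.2 - p.2)).
    by move: pq; rewrite /dot; lra.
  apply: (@cramer_eq N1 (- N1.2, N1.1)).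
  - by rewrite /det2 /= mulrN opprK -!expr2 gt_eqF.
  - by rewrite -pq /dot /=; ring.
  - rewrite /dot /= /n2; field; exact: lt0r_neq0.
have [t xE] := along V x (etrans V1 (esym x1)).
have [t' VE] := along x V' (etrans x1 (esym V1')).
have t0 : 0 <= t.
  have : 0 <= t * det2 N0 N1.
    by move: x0; rewrite -V0 xE /dot /det2 /=; lra.
  by rewrite pmulr_lge0.
have t'0 : 0 <= t'.
  have : 0 <= t' * det2 N1 N2.
    by move: x2; rewrite -V2' VE /dot /det2 /=; lra.
  by rewrite pmulr_lge0.
(* Here the side may shrink to the point V = x = V', where the ratio t / (t + t') is meaningless. *)
have [tt|tt] := eqVneq (t + t') 0.
  have e : t = 0 by lra.
  exists 0; rewrite ?lexx ?ler01 // convex_combE xE e /=.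
  by congr (_, _); ring.
exists (t / (t + t')).
  by rewrite divr_ge0 ?addr_ge0 //= ler_pdivrMr ?mul1r ?lerDl // lt_def tt addr_ge0.
by rewrite convex_combE VE xE /=; congr (_, _); field.
Qed.
End PlaneConvexity.

(** * Newton polygons and lattice segments *)

Section NewtonPolygon.
Context {R : realType} (A : {poly {poly int}}).
Local Notation NP := (@Newton_polygon R A).
Local Notation real := (toplane R).

Lemma det2_toplane N N' : det2 (real N) (real N') = (det2 N N')%:~R.
Proof. by rewrite /det2 rmorphB !rmorphM. Qed.

Lemma dot_toplane N x : dot (real N) (real x) = (dot N x)%:~R.
Proof. by rewrite /dot rmorphD !rmorphM. Qed.

Lemma toplane_inj : injective real.
Proof. by move=> [a b] [c d] [] /intr_inj -> /intr_inj ->. Qed.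

Lemma Newton_polygon_point p : coef2 A p != 0 -> NP (real p).
Proof.
move=> hp; exists 1, (fun=> p), (fun=> 1); split=> //; first by rewrite big_ord1.
by rewrite big_ord1 scale1r.
Qed.

Lemma Newton_polygon_segment p q x : coef2 A p != 0 -> coef2 A q != 0 ->
  segment (real p) (real q) x -> NP x.
Proof.
move=> hp hq [t /andP[t0 t1] ->].
exists 2, (fun i => if i == ord0 then p else q).
exists (fun i => if i == ord0 then 1 - t else t); split.
- by move=> i; case: ifP.
- by move=> i; case: ifP => // _; rewrite subr_ge0.
- by rewrite big_ord_recl big_ord1 /= subrK.
- by rewrite big_ord_recl big_ord1.
Qed.

Lemma dot_sum (N : R * R) I (r : seq I) (F : I -> R * R) :
  dot N (\sum_(i <- r) F i) = \sum_(i <- r) dot N (F i).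
Proof.
apply: (big_morph (dot N)) => [x y|]; last by rewrite /dot /=; ring.
rewrite /dot.
have -> : (x + y).1 = x.1 + y.1 by [].
have -> : (x + y).2 = x.2 + y.2 by [].
ring.
Qed.

Lemma Newton_polygon_le (N : int * int) c x :
  (forall p, coef2 A p != 0 -> dot N p <= c) -> NP x -> dot (real N) x <= c%:~R.
Proof.
move=> h [k [s [w [hs w0 w1 ->]]]]; rewrite dot_sum.
have -> : c%:~R = \sum_i w i * c%:~R by rewrite -mulr_suml w1 mul1r.
apply: ler_sum => i _.
have -> : dot (real N) (w i *: (real (s i) : R^o * R^o)) =
    w i * dot (real N) (real (s i)).
  by rewrite /dot /= /GRing.scale /=; ring.
by apply: ler_wpM2l => //; rewrite dot_toplane ler_int h.
Qed.

Lemma segment_left (p q : R * R) : segment p q p.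
Proof.
exists 0; rewrite ?lexx ?ler01 // convex_combE.
by case: p => a b /=; congr (_, _); ring.
Qed.

Lemma segment_sym (p q x : R * R) : segment p q x <-> segment q p x.
Proof.
by split=> -[t tt ->]; exists (1 - t); [lra | | lra |];
  rewrite !convex_combE; congr (_, _); ring.
Qed.

Lemma segment_right (p q : R * R) : segment p q q.
Proof. exact/segment_sym/segment_left. Qed.

Lemma left_of_asym p q : left_of p q -> left_of q p -> False.
Proof. by case=> [|[]] h1 => [|h2] [|[]] h3 => [|h4||h4]; lia. Qed.

Lemma left_of_total p q : p <> q -> left_of p q \/ left_of q p.
Proof.
case: p q => [a b] [c d]; rewrite /left_of /= => h.
have [||e] := ltgtP a c; [by left; left | by right; left|].
have [||e'] := ltgtP b d; [by left; right | by right; right|].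
by rewrite e e' in h.
Qed.

(** The left endpoint is the lexicographically least lattice point, hence determined by the segment
    as a set. *)
Lemma segment_first p q x : left_of p q -> segment (real p) (real q) (real x) ->
  x = p \/ left_of p x.
Proof.
move=> pq [t /andP[t0 t1]]; rewrite convex_combE => -[e1 e2].
move: t0; rewrite le_eqVlt => /predU1P[t0|t0].
  by left; apply: toplane_inj; rewrite /toplane e1 e2 -t0; congr (_, _); ring.
right; case: pq => [h|[h1 h2]].
  left; rewrite -(ltr_int R) e1 -subr_gt0.
  have -> : (1 - t) * p.1%:~R + t * q.1%:~R - p.1%:~R =
    t * (q.1%:~R - p.1%:~R) by ring.
  by rewrite mulr_gt0 // subr_gt0 ltr_int.
right; split.
  by apply: (@intr_inj R); rewrite e1 h1; ring.
rewrite -(ltr_int R) e2 -subr_gt0.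
have -> : (1 - t) * p.2%:~R + t * q.2%:~R - p.2%:~R =
  t * (q.2%:~R - p.2%:~R) by ring.
by rewrite mulr_gt0 // subr_gt0 ltr_int.
Qed.

Lemma segment_first_inj p q p' q' : left_of p q -> left_of p' q' ->
  (forall x, segment (real p) (real q) x <-> segment (real p') (real q') x) ->
  p = p'.
Proof.
move=> pq pq' h.
have /(segment_first _ _ _ pq') := (h _).1 (segment_left _ _).
have /(segment_first _ _ _ pq) := (h _).2 (segment_left _ _).
by case=> [//|l1] [//|l2]; case: (left_of_asym _ _ l1 l2).
Qed.

Lemma left_of_opp p q : left_of p q -> left_of (- q) (- p).
Proof. by case=> [|[]] h => [|h']; [left | right; split]; rewrite /=; lia. Qed.

(** The reflection through the origin reverses [left_of], so the case of left endpoints also yields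
    that of right endpoints. *)
Lemma segment_inj p q p' q' : left_of p q -> left_of p' q' ->
  (forall x, segment (real p) (real q) x <-> segment (real p') (real q') x) ->
  (p, q) = (p', q').
Proof.
move=> pq pq' h; rewrite (segment_first_inj _ _ _ _ pq pq' h); congr (_, _).
have segN a b (x : R * R) : segment (real (- a)) (real (- b)) x <->
    segment (real b) (real a) (- x.1, - x.2).
  rewrite segment_sym; split=> -[t tt]; rewrite convex_combE => e; exists t => //.
  - by rewrite e convex_combE /=; congr (_, _); rewrite !rmorphN; ring.
  - move: e; case: x => x1 x2 /= [e1 e2]; rewrite convex_combE /= !rmorphN.
    by congr (_, _); [rewrite -[x1]opprK e1 | rewrite -[x2]opprK e2]; ring.
apply: oppr_inj.
apply: segment_first_inj (left_of_opp _ _ pq) (left_of_opp _ _ pq') _ => x.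
by rewrite !segN.
Qed.

End NewtonPolygon.

(* The [N i] are outer normals in counterclockwise order and [V i] is the
   corner between the sides with normals [N i] and [N i.+1]; indices run past 6
   in order to wrap around. *)
Section Hexagon.
Context {R : realType} (A : {poly {poly int}}).
Local Notation NP := (@Newton_polygon R A).
Local Notation real := (toplane R).
Variables (N V : nat -> int * int) (c : nat -> int).
Hypotheses (N3 : N 3 = - N 0) (N6 : N 6 = N 0).
Hypothesis det_gt0 : forall i, (i < 7)%N -> 0 < det2 (N i) (N i.+1).
Hypothesis supp_le :
  forall i p, (i < 8)%N -> coef2 A p != 0 -> dot (N i) p <= c i.
Hypothesis corner : forall i, (i < 7)%N ->
  [/\ coef2 A (V i) != 0, dot (N i) (V i) = c i & dot (N i.+1) (V i) = c i.+1].

Let le_c i x : (i < 8)%N -> NP x -> dot (real (N i)) x <= (c i)%:~R.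
Proof. by move=> i8; apply: Newton_polygon_le => p; apply: supp_le. Qed.

Let VP i : (i < 7)%N -> NP (real (V i)).
Proof. by move=> /corner[h _ _]; apply: Newton_polygon_point. Qed.

Let V1 i : (i < 7)%N -> dot (real (N i)) (real (V i)) = (c i)%:~R.
Proof. by move=> /corner[_ h _]; rewrite dot_toplane h. Qed.

Let V2 i : (i < 7)%N -> dot (real (N i.+1)) (real (V i)) = (c i.+1)%:~R.
Proof. by move=> /corner[_ _ h]; rewrite dot_toplane h. Qed.

Let D i : (i < 7)%N -> 0 < det2 (real (N i)) (real (N i.+1)).
Proof. by move=> /det_gt0; rewrite det2_toplane ltr0z. Qed.

Lemma hexagon_side i x : (i < 6)%N ->
  NP x /\ dot (real (N i.+1)) x = (c i.+1)%:~R <->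
  segment (real (V i)) (real (V i.+1)) x.
Proof.
move=> i6; have i7 : (i < 7)%N by lia.
apply: (@side_segment R NP (real (N i)) _ (real (N i.+2)) (c i)%:~R _
  (c i.+2)%:~R); rewrite ?D ?V1 ?V2 //.
- by move=> z; apply: le_c; lia.
- by move=> z; apply: le_c; lia.
- move=> z; have [hi _ _] := corner _ i7; have [hi' _ _] := corner i.+1 i6.
  exact: Newton_polygon_segment.
Qed.

(** The values [f i] = det2 (N i) w satisfy f 3 = - f 0 and f 6 = f 0, so they pass from nonnegative
    to nonpositive within 0..3 or within 3..6, according to the sign of f 0. *)
Lemma hexagon_cone (w : R * R) : exists i, [/\ (i < 6)%N,
  0 <= det2 (real (N i)) w & 0 <= det2 w (real (N i.+1))].
Proof.
pose f i := det2 (real (N i)) w.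
have f3 : f 3%N = - f 0%N.
  by rewrite /f N3 /det2 /toplane /= !rmorphN; ring.
have f6 : f 6%N = f 0%N by rewrite /f N6.
suff [i [i6 h1 h2]] : exists i, [/\ (i < 6)%N, 0 <= f i & f i.+1 <= 0].
  by exists i; split=> //; rewrite det2C oppr_ge0.
have [h0|h0] := lerP 0 (f 0%N).
  have [h1|h1] := lerP (f 1%N) 0; first by exists 0.
  have [h2|h2] := lerP (f 2) 0; first by exists 1; rewrite h2 ltW.
  by exists 2; rewrite f3 oppr_le0 h0 ltW.
have h3 : 0 <= f 3%N by rewrite f3 oppr_ge0 ltW.
have [h1|h1] := lerP (f 4%N) 0; first by exists 3.
have [h2|h2] := lerP (f 5) 0; first by exists 4; rewrite h2 ltW.
by exists 5; rewrite f6 !ltW.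
Qed.

(** The normal of an edge lies in the cone of some corner. It is maximal at two distinct points, so
    [corner_normal] puts it on a boundary ray of the cone, and its face is the corresponding side.
    Consecutive corners may coincide; [left_of] discards such sides. *)
Lemma hexagon_edges e : is_edge R A e <-> left_of e.1 e.2 /\
  exists2 i, (i < 6)%N & e = (V i, V i.+1) \/ e = (V i.+1, V i).
Proof.
split=> [[le [u [v [c' [uv hle hface]]]]]|[le [i i6 he]]]; last first.
  split=> //; exists (real (N i.+1)).1, (real (N i.+1)).2, (c i.+1)%:~R; split.
  - case=> e1 e2; have := D i (ltnW i6).
    by rewrite /det2 /= e1 e2 !mulr0 subrr ltxx.
  - by move=> x; apply: le_c; lia.
  - move=> x; have := hexagon_side i x i6; rewrite /dot => ->.
    by case: he => -> //=; apply: segment_sym.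
split=> //; set w := (u, v) in uv.
have lew x : NP x -> dot w x <= c' by apply: hle.
have [Pp wp] := (hface _).2 (segment_left _ _).
have [Pq wq] := (hface _).2 (segment_right _ _).
have pq : real e.1 <> real e.2.
  by move=> /toplane_inj h; rewrite h in le; case: (left_of_asym _ _ le le).
have [i [i6 [r r0 wE]]] : exists i, (i < 6)%N /\ exists2 r, 0 < r &
    w = (r * (real (N i.+1)).1, r * (real (N i.+1)).2).
  have [i [i6 w1 w2]] := hexagon_cone w; have i7 : (i < 7)%N := ltnW i6.
  have i8 : (i < 8)%N := ltnW i7.
  have Di := D i i7.
  have r_gt0 r (N' : R * R) : 0 <= r -> w = (r * N'.1, r * N'.2) -> 0 < r.
    rewrite le_eqVlt => /predU1P[<-|//]; rewrite !mul0r => e0.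
    by case: uv.
  have [h|h] := corner_normal Di (VP i i7) (le_c i ^~ i8) (V1 i i7)
    (le_c i.+1 ^~ i7) (V2 i i7) w1 w2 lew _ _ Pp Pq pq wp wq.
  - have wE := det2_eq0_l h Di.
    have r0 := r_gt0 _ _ (divr_ge0 w2 (ltW Di)) wE.
    (* The normal [N 0] is not of the form [N i.+1]; it is replaced by its copy [N 6]. *)
    case: i i6 i7 i8 w1 w2 Di h wE r0 => [|i] i6 *.
      by exists 5; split=> //; rewrite N6; eexists; eassumption.
    by exists i; split; [lia | eexists; eassumption].
  - have wE := det2_eq0_r h Di.
    exists i; split=> //; eexists; last exact: wE.
    exact: r_gt0 _ _ (divr_ge0 w1 (ltW Di)) wE.
have i7 : (i < 7)%N := ltnW i6.
have face := parallel_face (le_c i.+1 ^~ i7) (VP i i7) (V2 i i7) lew Pp wp r r0 wE.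
have segE x : segment (real e.1) (real e.2) x <->
    segment (real (V i)) (real (V i.+1)) x.
  rewrite -hexagon_side // -hface; split=> -[Px]; first by move/(face _ Px).
  by move/(face _ Px).
have VV : V i <> V i.+1.
  move=> h; case: pq; rewrite -h in segE.
  have pt x : segment (real (V i)) (real (V i)) x -> x = real (V i).
    by case=> t _ ->; rewrite convex_combE; case: (real _) => a b /=;
      congr (_, _); ring.
  by rewrite (pt _ ((segE _).1 (segment_left _ _)))
    (pt _ ((segE _).1 (segment_right _ _))).
exists i => //; case: e le {pq Pp wp Pq wq hface} segE => p q /= le segE.
have [l|l] := left_of_total _ _ VV.
  by left; apply: segment_inj le l segE.
right; apply: (@segment_inj R _ _ _ _ le l) => x; rewrite segE; exact: segment_sym.
Qed.

End Hexagon.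

(** * Leading forms *)

Lemma sum_neq0 {I : finType} {V : nmodType} {F : I -> V} :
  \sum_i F i != 0 -> exists i, F i != 0.
Proof.
move=> nz; apply/existsP; apply: contraNT nz; rewrite negb_exists.
by move=> /forallP h; apply/eqP/big1 => i _; apply/eqP; rewrite -[_ == _]negbK h.
Qed.

Section WeightFiltration.
Context {N : int * int}.
Implicit Types (c d : int) (P Q F G : polyLM).

Definition weight_le c P : Prop :=
  forall b a : nat, P`_b`_a != 0 -> dot N (b%:Z, a%:Z) <= c.

(** A congruence modulo weight below [c]: [F] need not be homogeneous and may be 0. This makes it
    stable under sums in which top terms cancel; only the coefficients of weight exactly [c] carry
    information ([coef_lead]). *)
Definition has_lead c P F : Prop := weight_le c F /\ weight_le (c - 1) (P - F).

Lemma weight_leW d {c P} : weight_le c P -> c <= d -> weight_le d P.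
Proof. by move=> h cd b a /h /le_trans; apply. Qed.

Lemma weight_le0 c : weight_le c 0.
Proof. by move=> b a; rewrite !coef0 eqxx. Qed.

Lemma weight_leD c P Q : weight_le c P -> weight_le c Q -> weight_le c (P + Q).
Proof.
move=> hP hQ b a; rewrite !coefD; have [->|/hP //] := eqVneq P`_b`_a 0.
by rewrite add0r => /hQ.
Qed.

Lemma weight_leN c P : weight_le c P -> weight_le c (- P).
Proof. by move=> hP b a; rewrite !coefN oppr_eq0 => /hP. Qed.

Lemma weight_leM {c d P Q} :
  weight_le c P -> weight_le d Q -> weight_le (c + d) (P * Q).
Proof.
move=> hP hQ b a; rewrite coefM coef_sum => /sum_neq0 [i +].
rewrite coefM => /sum_neq0 [j +]; rewrite mulf_eq0 negb_or => /andP[/hP + /hQ].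
have := ltn_ord i; have := ltn_ord j; rewrite /dot /= !ltnS => ja ib.
by rewrite -!subzn // !mulrBr => h1 h2; lra.
Qed.

Lemma weight_le_monomial c (b a : nat) :
  dot N (b%:Z, a%:Z) <= c -> weight_le c ('X^b * 'X%:P ^+ a).
Proof.
move=> h b' a'; rewrite -rmorphXn coefMC coefXn.
have [->|_] := eqVneq b' b; last by rewrite mul0r coef0 eqxx.
by rewrite mul1r coefXn; have [->|_] := eqVneq a' a.
Qed.

Lemma weight_le1 c : 0 <= c -> weight_le c 1.
Proof.
move=> h; have := @weight_le_monomial c 0 0; rewrite !expr0 mulr1; apply.
by rewrite /dot /= !mulr0 addr0.
Qed.

Lemma weight_leX c : N.1 <= c -> weight_le c 'X.
Proof.
move=> h; have := @weight_le_monomial c 1 0; rewrite expr1 expr0 mulr1; apply.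
by rewrite /dot /= mulr1 mulr0 addr0.
Qed.

Lemma weight_leY c a : N.2 * a%:Z <= c -> weight_le c ('X%:P ^+ a).
Proof.
move=> h; have := @weight_le_monomial c 0 a; rewrite expr0 mul1r; apply.
by rewrite /dot /= mulr0 add0r.
Qed.

Lemma weight_leXY c a : N.1 + N.2 * a%:Z <= c -> weight_le c ('X * 'X%:P ^+ a).
Proof.
move=> h; have := @weight_le_monomial c 1 a; rewrite expr1; apply.
by rewrite /dot /= mulr1.
Qed.

Lemma weight_le_lead {c P F} : has_lead c P F -> weight_le c P.
Proof.
move=> [hF hPF]; rewrite -(subrK F P); apply: weight_leD => //.
by apply: (weight_leW c hPF); lia.
Qed.

Lemma has_leadr c P : weight_le c P -> has_lead c P P.
Proof. by move=> hP; split; rewrite // subrr; apply: weight_le0. Qed.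

Lemma has_lead_low c P : weight_le (c - 1) P -> has_lead c P 0.
Proof. by split; [apply: weight_le0 | rewrite subr0]. Qed.

Lemma has_leadD {c P Q F G} :
  has_lead c P F -> has_lead c Q G -> has_lead c (P + Q) (F + G).
Proof.
move=> [hF hPF] [hG hQG]; split; first exact: weight_leD.
by rewrite opprD addrACA; apply: weight_leD.
Qed.

Lemma has_leadN c P F : has_lead c P F -> has_lead c (- P) (- F).
Proof.
by move=> [hF hPF]; split; [| rewrite -opprD]; apply: weight_leN.
Qed.

Lemma has_leadDl c P F Q : has_lead c P F -> weight_le (c - 1) Q ->
  has_lead c (P + Q) F.
Proof.
by move=> hP hQ; rewrite -[F]addr0; apply: has_leadD hP (has_lead_low _ _ hQ).
Qed.

Lemma has_leadDr c P F Q : has_lead c P F -> weight_le (c - 1) Q ->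
  has_lead c (Q + P) F.
Proof. by move=> hP hQ; rewrite addrC; apply: has_leadDl. Qed.

Lemma has_leadM {c d P Q F G} :
  has_lead c P F -> has_lead d Q G -> has_lead (c + d) (P * Q) (F * G).
Proof.
move=> hP hQ; split; first exact: weight_leM hP.1 hQ.1.
have -> : P * Q - F * G = (P - F) * Q + F * (Q - G) by ring.
apply: weight_leD.
- have := weight_leM hP.2 (weight_le_lead hQ).
  by move=> /(weight_leW (c + d - 1)); apply; lia.
- by have := weight_leM hP.1 hQ.2; rewrite addrA.
Qed.

Lemma has_leadX {c P F} n :
  has_lead c P F -> has_lead (c * n%:Z) (P ^+ n) (F ^+ n).
Proof.
move=> hP; elim: n => [|n IHn].
  by rewrite mulr0; apply/has_leadr/weight_le1.
have -> : c * n.+1%:Z = c + c * n%:Z by lia.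
by rewrite !exprS; apply: has_leadM.
Qed.

Lemma has_lead_cast {c P F} c' F' :
  has_lead c P F -> c = c' -> F = F' -> has_lead c' P F'.
Proof. by move=> h <- <-. Qed.

Lemma coef_lead {c P F} (b a : nat) : has_lead c P F ->
  dot N (b%:Z, a%:Z) = c -> P`_b`_a = F`_b`_a.
Proof.
move=> [_ h] e; apply/eqP; rewrite -subr_eq0 -!coefB; apply: contraT => /h.
by rewrite e; lia.
Qed.

End WeightFiltration.

Arguments weight_le N c P : clear implicits.
Arguments has_lead N c P F : clear implicits.

Section TwistRecursion.
Context {N : int * int} {c : int} {al be ga de : polyLM}.
Local Notation E n := (linear_pair al be ga de n).1.
Local Notation O n := (linear_pair al be ga de n).2.

Lemma linear_pair1S n : E n.+1 = al * E n + be * O n.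
Proof. by []. Qed.

Lemma linear_pair2S n : O n.+1 = ga * O n + de * E n.
Proof. by []. Qed.

(** The odd part stays 2 below the even part: it is fed through [de], which gains only 2 where [al]
    gains 4, and [be], gaining at most 4, cannot make up the gap. *)
Lemma lead_even_dominant a n : has_lead N 4 al a ->
  weight_le N 4 be -> weight_le N 4 ga -> weight_le N 2 de ->
  has_lead N (4 * n%:Z) (E n) (a ^+ n) /\ weight_le N (4 * n%:Z - 2) (O n).
Proof.
move=> ha hb hg hd; elim: n => [|n [IE IO]].
  split; last exact: weight_le0.
  exact/has_leadr/weight_le1.
rewrite linear_pair1S linear_pair2S; split.
  have -> : 4 * n.+1%:Z = 4 + 4 * n%:Z by lia.
  rewrite exprS; apply: has_leadDl; first exact: has_leadM.
  by apply: weight_leW (weight_leM hb IO) _; lia.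
apply: weight_leD.
  by apply: weight_leW (weight_leM hg IO) _; lia.
by apply: weight_leW (weight_leM hd (weight_le_lead IE)) _; lia.
Qed.

(** To top order [be] and [ga] vanish: the even part is multiplied by [a], and the odd part is just
    [d] times the previous even part. Both then have the same weight. The index is n + 1 for the odd
    part because it starts at 0. *)
Lemma lead_geometric a d n : has_lead N c al a -> has_lead N c de d ->
  weight_le N (c - 1) be -> weight_le N (c - 1) ga ->
  [/\ has_lead N (c * n%:Z) (E n) (a ^+ n), weight_le N (c * n%:Z) (O n)
    & has_lead N (c * n.+1%:Z) (O n.+1) (d * a ^+ n)].
Proof.
move=> ha hd hb hg.
have cS m : c * m.+1%:Z = c + c * m%:Z by lia.
have IH : has_lead N (c * n%:Z) (E n) (a ^+ n) /\ weight_le N (c * n%:Z) (O n).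
  elim: n => [|n [IE IO]].
    rewrite mulr0; split; last exact: weight_le0.
    exact/has_leadr/weight_le1.
  rewrite linear_pair1S linear_pair2S cS exprS; split.
    apply: has_leadDl; first exact: has_leadM.
    by apply: weight_leW (weight_leM hb IO) _; lia.
  apply: weight_leD; last exact: weight_leM (weight_le_lead hd) (weight_le_lead IE).
  by apply: weight_leW (weight_leM hg IO) _; lia.
split; [exact: IH.1 | exact: IH.2 |].
rewrite linear_pair2S cS; apply: has_leadDr; first exact: has_leadM hd IH.1.
by apply: weight_leW (weight_leM hg IH.2) _; lia.
Qed.

Lemma lead_linear a b g d n :
  has_lead N c al a -> has_lead N c be b ->
  has_lead N c ga g -> has_lead N c de d ->
  has_lead N (c * n%:Z) (E n) (linear_pair a b g d n).1 /\
  has_lead N (c * n%:Z) (O n) (linear_pair a b g d n).2.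
Proof.
move=> ha hb hg hd; elim: n => [|n [IE IO]].
  rewrite mulr0; split; apply: has_leadr; last exact: weight_le0.
  exact: weight_le1.
have -> : c * n.+1%:Z = c + c * n%:Z by lia.
by split; apply: has_leadD; apply: has_leadM.
Qed.

End TwistRecursion.

Ltac solve_weight :=
  lazymatch goal with
  | |- weight_le _ _ (_ + _) => apply: weight_leD; solve_weight
  | |- weight_le _ _ (- _) => apply: weight_leN; solve_weight
  | |- weight_le _ _ (_ * _) => exact: weight_leXY
  | |- weight_le _ _ (_ ^+ _) => exact: weight_leY
  | |- weight_le _ _ 'X => exact: weight_leX
  | |- _ => exact: weight_le1
  end.

Ltac lead_all := apply: has_leadr; solve_weight.
Ltac lead_fst := apply: has_leadDl; [apply: has_leadr |]; solve_weight.
Ltac lead_snd := apply: has_leadDr; [apply: has_leadr |]; solve_weight.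

Local Notation M := ('X%:P : polyLM).
Local Notation L := ('X : polyLM).

(** * Leading forms of the twist recursion in six directions *)

Section LeadingForms.
Local Notation y := (1 + L * M ^+ 2).
Local Notation u := (1 - M ^+ 2).
Local Notation l := (L - 1).
Local Notation k := (L * M ^+ 4 - 1).
Local Notation m := (M ^+ 2).
Local Notation even_part n := (twist_pair L M n).1.
Local Notation odd_part n := (twist_pair L M n).2.

(** The factors y, u, l, k, m have weights 0, 2, 0, 0, 2, so u^2 l k (weight 4) beats y^2 m (weight
    2). Both terms of k = L M^4 - 1 have weight 0: k survives whole and becomes t - 1. *)
Lemma lead_upper_left n :
  has_lead (- 4, 1) (4 * n%:Z) (even_part n) (((- m) ^+ 2 * - 1 * k) ^+ n) /\
  weight_le (- 4, 1) (4 * n%:Z - 2) (odd_part n).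
Proof.
have hy : has_lead (- 4, 1) 0 y 1 by lead_fst.
have hu : has_lead (- 4, 1) 2 u (- m) by lead_snd.
have hl : has_lead (- 4, 1) 0 l (- 1) by lead_snd.
have hk : has_lead (- 4, 1) 0 k k by lead_all.
have hm : has_lead (- 4, 1) 2 m m by lead_all.
apply: lead_even_dominant.
- apply: has_leadDr.
  + exact: has_leadM (has_leadM (has_leadX 2 hu) hl) hk.
  + apply: weight_leW (weight_le_lead (has_leadM (has_leadX 2 hy) hm)) _.
    by [].
- exact: weight_le_lead (has_leadM (has_leadM (has_leadM hu hl) hy) hm).
- by apply: weight_leW (weight_le_lead (has_leadM (has_leadX 2 hy) hm)) _.
- exact: weight_le_lead (has_leadM (has_leadM hu hk) hy).
Qed.

Lemma lead_lower_right n :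
  has_lead (4, - 1) (4 * n%:Z) (even_part n) ((1 ^+ 2 * L * k) ^+ n) /\
  weight_le (4, - 1) (4 * n%:Z - 2) (odd_part n).
Proof.
have hy : has_lead (4, - 1) 2 y (L * m) by lead_snd.
have hu : has_lead (4, - 1) 0 u 1 by lead_fst.
have hl : has_lead (4, - 1) 4 l L by lead_fst.
have hk : has_lead (4, - 1) 0 k k by lead_all.
have hm : has_lead (4, - 1) (- 2) m m by lead_all.
apply: lead_even_dominant.
- apply: has_leadDr.
  + exact: has_leadM (has_leadM (has_leadX 2 hu) hl) hk.
  + by apply: weight_leW (weight_le_lead (has_leadM (has_leadX 2 hy) hm)) _.
- exact: weight_le_lead (has_leadM (has_leadM (has_leadM hu hl) hy) hm).
- by apply: weight_leW (weight_le_lead (has_leadM (has_leadX 2 hy) hm)) _.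
- exact: weight_le_lead (has_leadM (has_leadM hu hk) hy).
Qed.

Lemma lead_top n :
  [/\ has_lead (0, 1) (8 * n%:Z) (even_part n)
         (((- m) ^+ 2 * l * (L * M ^+ 4)) ^+ n),
      weight_le (0, 1) (8 * n%:Z) (odd_part n)
    & has_lead (0, 1) (8 * n.+1%:Z) (odd_part n.+1)
        (- m * (L * M ^+ 4) * (L * m) * ((- m) ^+ 2 * l * (L * M ^+ 4)) ^+ n)].
Proof.
have hy : has_lead (0, 1) 2 y (L * m) by lead_snd.
have hu : has_lead (0, 1) 2 u (- m) by lead_snd.
have hl : has_lead (0, 1) 0 l l by lead_all.
have hk : has_lead (0, 1) 4 k (L * M ^+ 4) by lead_fst.
have hm : has_lead (0, 1) 2 m m by lead_all.
apply: lead_geometric.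
- apply: has_leadDr.
  + exact: has_leadM (has_leadM (has_leadX 2 hu) hl) hk.
  + by apply: weight_leW (weight_le_lead (has_leadM (has_leadX 2 hy) hm)) _.
- exact: has_leadM (has_leadM hu hk) hy.
- by apply: weight_leW
    (weight_le_lead (has_leadM (has_leadM (has_leadM hu hl) hy) hm)) _.
- by apply: weight_leW (weight_le_lead (has_leadM (has_leadX 2 hy) hm)) _.
Qed.

Lemma lead_bottom n :
  [/\ has_lead (0, - 1) 0 (even_part n) ((1 - L) ^+ n),
      weight_le (0, - 1) 0 (odd_part n)
    & has_lead (0, - 1) 0 (odd_part n.+1) (- (1 - L) ^+ n)].
Proof.
have hy : has_lead (0, - 1) 0 y 1 by lead_fst.
have hu : has_lead (0, - 1) 0 u 1 by lead_fst.
have hl : has_lead (0, - 1) 0 l l by lead_all.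
have hk : has_lead (0, - 1) 0 k (- 1) by lead_snd.
have hm : has_lead (0, - 1) (- 2) m m by lead_all.
have := @lead_geometric _ 0 _ _ _ _ _ _ n
  (has_leadDr _ _ _ _ (has_leadM (has_leadM (has_leadX 2 hu) hl) hk) _)
  (has_leadM (has_leadM hu hk) hy) _ _.
rewrite !mul0r expr1n mul1r mulrN1 opprB mul1r mulr1 mulN1r; apply.
- by apply: weight_leW (weight_le_lead (has_leadM (has_leadX 2 hy) hm)) _.
- by apply: weight_leW
    (weight_le_lead (has_leadM (has_leadM (has_leadM hu hl) hy) hm)) _.
- by apply: weight_leW (weight_le_lead (has_leadM (has_leadX 2 hy) hm)) _.
Qed.

(** At L = 0 the matrix of the recursion has left eigenvectors (1, 1) and (1, - m) with eigenvalues
    m^2 and 1. The first combination serves n > 0, the second n < 0. *)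
Lemma lead_left n : exists e o,
  [/\ has_lead (- 1, 0) 0 (even_part n) e, has_lead (- 1, 0) 0 (odd_part n) o,
      e + o = m ^+ n ^+ 2 & e - m * o = 1].
Proof.
have hy : has_lead (- 1, 0) 0 y 1 by lead_fst.
have hu : has_lead (- 1, 0) 0 u u by lead_all.
have hl : has_lead (- 1, 0) 0 l (- 1) by lead_snd.
have hk : has_lead (- 1, 0) 0 k (- 1) by lead_snd.
have hm : has_lead (- 1, 0) 0 m m by lead_all.
have [IE IO] := lead_linear (c := 0) _ _ _ _ n
  (has_leadD (has_leadM (has_leadX 2 hy) hm)
    (has_leadM (has_leadM (has_leadX 2 hu) hl) hk))
  (has_leadM (has_leadM (has_leadM hu hl) hy) hm)
  (has_leadM (has_leadX 2 hy) hm) (has_leadM (has_leadM hu hk) hy).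
set p := linear_pair (1 ^+ 2 * m + _) _ _ _ in IE IO; exists (p n).1, (p n).2.
rewrite mul0r in IE IO; split; [exact: IE | exact: IO | |]; elim: n {IE IO} => [|n IHn].
- by rewrite expr0 expr1n /= addr0.
- rewrite [m ^+ n.+1]exprS [(m * _) ^+ 2]exprMn -IHn /p /linear_pair iterS /=; ring.
- by rewrite /= mulr0 subr0.
- rewrite -[RHS]IHn /p /linear_pair iterS /=; ring.
Qed.

(** The matrix of L^2-terms has left eigenvectors (1, 1) and (m, -1), with eigenvalues L^2 M^4 and
    L^2 M^8. *)
Lemma lead_right n : exists e o,
  [/\ has_lead (1, 0) (2 * n%:Z) (even_part n) e,
      has_lead (1, 0) (2 * n%:Z) (odd_part n) o,
      e + o = (L ^+ 2 * M ^+ 4) ^+ n &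
      m * e - o = m * (L ^+ 2 * M ^+ 8) ^+ n].
Proof.
have hy : has_lead (1, 0) 1 y (L * m) by lead_snd.
have hu : has_lead (1, 0) 0 u u by lead_all.
have hl : has_lead (1, 0) 1 l L by lead_fst.
have hk : has_lead (1, 0) 1 k (L * M ^+ 4) by lead_fst.
have hm : has_lead (1, 0) 0 m m by lead_all.
have [IE IO] := lead_linear (c := 2) _ _ _ _ n
  (has_leadD (has_leadM (has_leadX 2 hy) hm)
    (has_leadM (has_leadM (has_leadX 2 hu) hl) hk))
  (has_leadM (has_leadM (has_leadM hu hl) hy) hm)
  (has_leadM (has_leadX 2 hy) hm) (has_leadM (has_leadM hu hk) hy).
set p := linear_pair ((L * m) ^+ 2 * m + _) _ _ _ in IE IO; exists (p n).1, (p n).2.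
split; [exact: IE | exact: IO | |]; elim: n {IE IO} => [|n IHn].
- by rewrite /= addr0.
- rewrite [_ ^+ n.+1]exprS -IHn /p /linear_pair iterS /=; ring.
- by rewrite /= subr0.
- rewrite [_ ^+ n.+1]exprS mulrCA -IHn /p /linear_pair iterS /=; ring.
Qed.

(** The common shape of all six forms: s = 4 on the sides of slope 4, s = 0 on horizontal sides, n =
    0 for a single monomial. *)
Definition edge_form (e b a s n : nat) : polyLM :=
  (-1) ^+ e * ('X^b * M ^+ a) * (L * M ^+ s - 1) ^+ n.

Lemma edge_form_horizontal e b a n :
  edge_form e b a 0 n = (-1) ^+ e * ('X^b * M ^+ a) * (L - 1) ^+ n.
Proof. by rewrite /edge_form expr0 mulr1. Qed.

(** The left side is (t - 1)^n at t = L M^s, which is how the edge polynomials are read off. *)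
Lemma coef_binomial s n j :
  ((L * M ^+ s - 1) ^+ n)`_j = (('X - 1 : {poly int}) ^+ n)`_j *: 'X^(s * j).
Proof.
elim: n j => [|n IHn] j.
  by rewrite !expr0 !coef1; case: j => [|j]; rewrite ?muln0 ?scale1r ?scale0r.
have -> : (L * M ^+ s - 1) ^+ n.+1 =
    (L * M ^+ s - 1) ^+ n * 'X * ('X^s)%:P - (L * M ^+ s - 1) ^+ n.
  by rewrite exprSr mulrBr mulr1 mulrA rmorphXn.
rewrite exprSr mulrBr mulr1 !coefB coefMC !coefMX IHn scalerBl.
case: j => [|j] /=; first by rewrite IHn mul0r scale0r.
by rewrite IHn -scalerAl -exprD mulnS addnC.
Qed.

Lemma coef_edge_form e b a s n j :
  (edge_form e b a s n)`_(b + j)`_(a + s * j) =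
  (-1) ^+ e * (('X - 1) ^+ n)`_j.
Proof.
have body : ('X^b * M ^+ a * (L * M ^+ s - 1) ^+ n)`_(b + j)`_(a + s * j) =
    (('X - 1 : {poly int}) ^+ n)`_j.
  rewrite -mulrA coefXnM ltnNge leq_addr /= addKn -[_ ^+ a]rmorphXn coefCM
    coef_binomial.
  by rewrite coefXnM ltnNge leq_addr /= addKn coefZ coefXn eqxx mulr1.
rewrite /edge_form -mulrA -signr_odd -[in RHS]signr_odd.
by case: (odd e); rewrite ?expr1 ?expr0 ?mulN1r ?mul1r ?coefN body.
Qed.

Lemma coef_subX1_exp0 n : (('X - 1 : {poly int}) ^+ n)`_0 = (-1) ^+ n.
Proof. by rewrite -horner_coef0 horner_exp !hornerE. Qed.

Lemma coef_subX1_exp_max n : (('X - 1 : {poly int}) ^+ n)`_n = 1.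
Proof.
have := monicP (monic_exp n (monicXsubC (1 : int))).
by rewrite lead_coefE size_exp_XsubC.
Qed.

Section Positive.
Variable n : nat.
Local Notation A := (twist_poly (Posz n) L M).

Lemma pos_upper_left :
  has_lead (- 4, 1) (4 * n%:Z) A (edge_form n.+1 0 (4 * n) 4 n).
Proof.
have [hE hO] := lead_upper_left n.
apply: has_lead_cast _ _ (has_leadN _ _ _ (has_leadDl _ _ _ _ hE _)) erefl _.
  by apply: weight_leW hO _; lia.
have -> : (- m) ^+ 2 * - 1 * k = - 1 * (M ^+ 4 * k) by ring.
rewrite /edge_form [(_ * _) ^+ n]exprMn [(_ * _) ^+ n]exprMn [(- 1) ^+ _]exprS
  [M ^+ (4 * n)]exprM. ring.
Qed.

Lemma pos_lower_right :
  has_lead (4, - 1) (4 * n%:Z) A (edge_form 1 n 0 4 n).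
Proof.
have [hE hO] := lead_lower_right n.
apply: has_lead_cast _ _ (has_leadN _ _ _ (has_leadDl _ _ _ _ hE _)) erefl _.
  by apply: weight_leW hO _; lia.
have -> : 1 ^+ 2 * L * k = L * k by ring.
rewrite /edge_form [(_ * _) ^+ n]exprMn; ring.
Qed.

Lemma pos_left : has_lead (- 1, 0) 0 A (edge_form 1 0 (4 * n) 0 0).
Proof.
have [e [o [hE hO eo _]]] := lead_left n.
apply: has_lead_cast _ _ (has_leadN _ _ _ (has_leadD hE hO)) erefl _.
rewrite eo /edge_form -!exprM (_ : 2 * (n * 2) = 4 * n)%N; [ring | lia].
Qed.

Lemma pos_right : has_lead (1, 0) (2 * n%:Z) A (edge_form 1 (2 * n) (4 * n) 0 0).
Proof.
have [e [o [hE hO eo _]]] := lead_right n.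
apply: has_lead_cast _ _ (has_leadN _ _ _ (has_leadD hE hO)) erefl _.
rewrite eo /edge_form [(_ * _) ^+ n]exprMn -!exprM; ring.
Qed.

End Positive.

(** Even and odd parts tie, and L M^8 (L - 1) - L^2 M^8 = - L M^8 removes one factor L - 1. At the
    bottom, (1 - L) - 1 = - L does the same. *)
Lemma pos_top n : has_lead (0, 1) (8 * n.+1%:Z) (twist_poly (Posz n.+1) L M)
  (edge_form 0 n.+1 (8 * n.+1) 0 n).
Proof.
have [hE _ _] := lead_top n.+1; have [_ _ hO] := lead_top n.
apply: has_lead_cast _ _ (has_leadN _ _ _ (has_leadD hE hO)) erefl _.
have -> : (- m) ^+ 2 * l * (L * M ^+ 4) = L * (M ^+ 8 * l) by ring.
rewrite edge_form_horizontal [(_ * _) ^+ n.+1]exprS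
  [(L * _) ^+ n]exprMn [(M ^+ 8 * _) ^+ n]exprMn.
have -> : M ^+ (8 * n.+1) = M ^+ 8 ^+ n * M ^+ 8 by rewrite exprM [RHS]mulrC -exprS.
rewrite [L ^+ n.+1]exprS. ring.
Qed.

Lemma pos_bottom n : has_lead (0, - 1) 0 (twist_poly (Posz n.+1) L M)
  (edge_form n 1 0 0 n).
Proof.
have [hE _ _] := lead_bottom n.+1; have [_ _ hO] := lead_bottom n.
apply: has_lead_cast _ _ (has_leadN _ _ _ (has_leadD hE hO)) erefl _.
have e : 1 - L = - 1 * (L - 1) by ring.
rewrite edge_form_horizontal [_ ^+ n.+1]exprS e [(_ * _) ^+ n]exprMn; ring.
Qed.

Section Negative.
Variable n : nat.
Local Notation A := (twist_poly (Negz n) L M).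

Lemma neg_upper_left :
  has_lead (- 4, 1) (4 * n%:Z + 2) A (edge_form n 1 (4 * n + 6) 4 n).
Proof.
have [hE hO] := lead_upper_left n.
have hc : has_lead (- 4, 1) 2 (1 + L * M ^+ 6) (L * M ^+ 6) by lead_snd.
have hd : weight_le (- 4, 1) 2 (M ^+ 2 + L * M ^+ 4) by solve_weight.
apply: has_lead_cast _ _ (has_leadDl _ _ _ _ (has_leadM hc hE) _) _ _.
- by apply: weight_leW (weight_leN _ _ (weight_leM hd hO)) _; lia.
- by rewrite addrC.
have -> : (- m) ^+ 2 * - 1 * k = - 1 * (M ^+ 4 * k) by ring.
rewrite /edge_form [(_ * _) ^+ n]exprMn [(_ * _) ^+ n]exprMn [M ^+ (_ + _)]exprD
  [M ^+ (4 * n)]exprM; ring.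
Qed.

Lemma neg_lower_right :
  has_lead (4, - 1) (4 * n%:Z) A (edge_form 0 n 0 4 n).
Proof.
have [hE hO] := lead_lower_right n.
have hc : has_lead (4, - 1) 0 (1 + L * M ^+ 6) 1 by lead_fst.
have hd : weight_le (4, - 1) 0 (M ^+ 2 + L * M ^+ 4) by solve_weight.
apply: has_lead_cast _ _ (has_leadDl _ _ _ _ (has_leadM hc hE) _) _ _.
- by apply: weight_leW (weight_leN _ _ (weight_leM hd hO)) _; lia.
- by rewrite add0r.
have -> : 1 ^+ 2 * L * k = L * k by ring.
rewrite /edge_form [(_ * _) ^+ n]exprMn; ring.
Qed.

(** No tie here: 1 + L M^6 has weight 6 against 4 for the coefficient of the odd part, so no factor
    L - 1 is lost. *)
Lemma neg_top : has_lead (0, 1) (8 * n%:Z + 6) A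
  (edge_form 0 n.+1 (8 * n + 6) 0 n).
Proof.
have [hE hO _] := lead_top n.
have hc : has_lead (0, 1) 6 (1 + L * M ^+ 6) (L * M ^+ 6) by lead_snd.
have hd : weight_le (0, 1) 4 (M ^+ 2 + L * M ^+ 4) by solve_weight.
apply: has_lead_cast _ _ (has_leadDl _ _ _ _ (has_leadM hc hE) _) _ _.
- by apply: weight_leW (weight_leN _ _ (weight_leM hd hO)) _; lia.
- by rewrite addrC.
have -> : (- m) ^+ 2 * l * (L * M ^+ 4) = L * (M ^+ 8 * l) by ring.
rewrite edge_form_horizontal [(_ * _) ^+ n]exprMn [(_ * _) ^+ n]exprMn [M ^+ (_ + _)]exprD
  [M ^+ (8 * n)]exprM [L ^+ n.+1]exprS; ring.
Qed.

Lemma neg_bottom : has_lead (0, - 1) 0 A (edge_form n 0 0 0 n).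
Proof.
have [hE hO _] := lead_bottom n.
have hc : has_lead (0, - 1) 0 (1 + L * M ^+ 6) 1 by lead_fst.
have hd : weight_le (0, - 1) (- 2) (M ^+ 2 + L * M ^+ 4) by solve_weight.
apply: has_lead_cast _ _ (has_leadDl _ _ _ _ (has_leadM hc hE) _) _ _.
- by apply: weight_leW (weight_leN _ _ (weight_leM hd hO)) _.
- by rewrite add0r.
have e : 1 - L = - 1 * (L - 1) by ring.
rewrite edge_form_horizontal e [(_ * _) ^+ n]exprMn; ring.
Qed.

Lemma neg_left : has_lead (- 1, 0) 0 A (edge_form 0 0 0 0 0).
Proof.
have [e [o [hE hO _ eo]]] := lead_left n.
have hc : has_lead (- 1, 0) 0 (1 + L * M ^+ 6) 1 by lead_fst.
have hd : has_lead (- 1, 0) 0 (M ^+ 2 + L * M ^+ 4) (M ^+ 2) by lead_fst.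
apply: has_lead_cast _ _
  (has_leadD (has_leadM hc hE) (has_leadN _ _ _ (has_leadM hd hO))) _ _.
  by rewrite add0r.
rewrite mul1r eo /edge_form; ring.
Qed.

Lemma neg_right : has_lead (1, 0) (2 * n%:Z + 1) A
  (edge_form 0 (2 * n).+1 (8 * n + 6) 0 0).
Proof.
have [e [o [hE hO _ eo]]] := lead_right n.
have hc : has_lead (1, 0) 1 (1 + L * M ^+ 6) (L * M ^+ 6) by lead_snd.
have hd : has_lead (1, 0) 1 (M ^+ 2 + L * M ^+ 4) (L * M ^+ 4) by lead_snd.
apply: has_lead_cast _ _
  (has_leadD (has_leadM hc hE) (has_leadN _ _ _ (has_leadM hd hO))) _ _.
  by rewrite addrC.
have -> : L * M ^+ 6 * e - L * M ^+ 4 * o = L * M ^+ 4 * (m * e - o) by ring.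
rewrite eo /edge_form [(_ * _) ^+ n]exprMn -!exprM [L ^+ _.+1]exprS [M ^+ (_ + _)]exprD; ring.
Qed.

End Negative.

End LeadingForms.

(** * The hexagons *)

Lemma coef2_le N c A F x : has_lead N c A F -> coef2 A x != 0 -> dot N x <= c.
Proof.
move=> h; case: x => [[b|b] [a|a]] //=; rewrite ?eqxx //.
exact: weight_le_lead h b a.
Qed.

Lemma coef2_edge_form N c A e b a s n (j : nat) x :
  has_lead N c A (edge_form e b a s n) -> dot N x = c ->
  x = (b%:Z + j%:Z, a%:Z + s%:Z * j%:Z) ->
  coef2 A x = (-1) ^+ e * (('X - 1) ^+ n)`_j.
Proof.
move=> h hc hx; rewrite -(coef_edge_form e b a s).
have -> : x = ((b + j)%N%:Z, (a + s * j)%N%:Z) by rewrite hx; congr (_, _); lia.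
by apply: (coef_lead _ _ h); rewrite -hc hx /dot /=; lia.
Qed.

(** A single monomial meets the weight bounds for (0, 1) and (0, -1) with opposite constants, which
    pins its exponent of M. *)
Lemma coef2_vertex N c A e b a s x : has_lead N c A (edge_form e b a s 0) ->
  coef2 A x != 0 -> dot N x = c -> x.2 = a%:Z.
Proof.
move=> h nz hc; have : dot (0, 1) x <= a%:Z /\ dot (0, -1) x <= - a%:Z.
  case: x nz hc => [[b'|b'] [a'|a']] //=; rewrite ?eqxx // => nz hc.
  have {}nz : (edge_form e b a s 0)`_b'`_a' != 0 by rewrite -(coef_lead _ _ h hc).
  have sgn N' : weight_le N' 0 ((-1) ^+ e).
    rewrite -signr_odd; case: odd; rewrite ?expr0; last exact: weight_le1.
    by rewrite expr1; apply/weight_leN/weight_le1.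
  have wt N' : weight_le N' (0 + dot N' (b%:Z, a%:Z) + 0) (edge_form e b a s 0).
    rewrite /edge_form expr0; apply: weight_leM (weight_le1 _ _) => //.
    by apply: weight_leM => //; apply: weight_le_monomial.
  by move: (wt (0, 1) _ _ nz) (wt (0, -1) _ _ nz); rewrite /dot /=; lia.
by rewrite /dot /=; lia.
Qed.

Definition edge_from (p : int * int) (s : int) (k : nat) :=
  (p, (p.1 + k%:Z, p.2 + s * k%:Z)).

Lemma edge_from_length p s k : edge_length (edge_from p s k) = k.
Proof.
rewrite /edge_length /edge_from /= ![_ + _ - _]addrAC !subrr !add0r.
by rewrite abszM gcdnMl.
Qed.

Lemma edge_from_dir p s k : (0 < k)%N -> edge_dir (edge_from p s k) = (1, s).
Proof.
move=> k0; rewrite /edge_dir edge_from_length /=.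
rewrite ![_ + _ - _]addrAC !subrr !add0r.
have nz : k%:Z != 0 by lia.
by rewrite divzz nz mulzK.
Qed.

Lemma edge_from_slope p s k a :
  (0 < k)%N -> has_slope (edge_from p s k) a <-> a = s.
Proof. by move=> k0; rewrite /has_slope edge_from_dir //; split=> [[]|->]. Qed.

(** The last condition says that the side is a level line of [N], so each of its points has the top
    weight and [coef_lead] applies there. *)
Lemma edge_poly_edge_from A N c e (b a s n : nat) : (0 < n)%N ->
  has_lead N c A (edge_form e b a s n) -> dot N (b%:Z, a%:Z) = c ->
  dot N (1, s%:Z) = 0 ->
  edge_poly A (edge_from (b%:Z, a%:Z) s n) = (-1) ^+ e * ('X - 1) ^+ n.
Proof.
move=> n0 h hc h0; apply/polyP => j.
rewrite /edge_poly edge_from_length edge_from_dir // coef_poly.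
have -> : ((-1) ^+ e * ('X - 1) ^+ n : {poly int})`_j =
    (-1) ^+ e * (('X - 1) ^+ n)`_j.
  rewrite -signr_odd -[in RHS]signr_odd.
  by case: odd; rewrite ?expr1 ?expr0 ?mulN1r ?mul1r ?coefN.
case: ltnP => [jn|nj]; last first.
  by rewrite [X in _ * X]nth_default ?mulr0 // size_exp_XsubC.
have xE : (b%:Z, a%:Z) + (1, s%:Z) *+ j = (b%:Z + j%:Z, a%:Z + s%:Z * j%:Z).
  rewrite -[RHS]/((b%:Z, a%:Z) + (j%:Z, s%:Z * j%:Z)); congr (_ + _).
  elim: (j) => [|i IHi]; first by rewrite mulr0.
  rewrite mulrS IHi; apply: (congr2 pair); rewrite /=; lia.
apply: (coef2_edge_form _ _ _ _ _ _ _ _ _ _ h _ xE).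
by move: hc h0; rewrite xE /dot /=; lia.
Qed.

Lemma edge_poly_length1 A p s :
  edge_poly A (edge_from p s 1) =
  (coef2 A p)%:P + (coef2 A (p.1 + 1, p.2 + s))%:P * 'X.
Proof.
apply/polyP => j; rewrite /edge_poly edge_from_length edge_from_dir // coef_poly.
rewrite coefD coefC coefMX coefC; case: j => [|[|j]] /=.
- by case: p => a b; rewrite !addr0.
- by rewrite add0r.
- by rewrite addr0.
Qed.

Lemma edge_from_left_of p s k :
  left_of (edge_from p s k).1 (edge_from p s k).2 <-> (0 < k)%N.
Proof.
rewrite /left_of /edge_from /=; split=> [h|k0]; last by left; lia.
by case: k h => [|//]; rewrite mulr0; lia.
Qed.

(* The sides of the hexagon in cyclic order, given by the slope, the left
   endpoint and the width of each of them; a side of width 0 is a corner. *)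
Section ThreeSlopes.
Context {R : realType} {A : {poly {poly int}}}.
Variables (N V : nat -> int * int) (c : nat -> int).
Variables (s : int) (k0 k4 : nat) (p : nat -> int * int).
Let slope i : int := nth 0 [:: 4; s; 0; 4; s; 0] i.
Let width i : nat := nth 0%N [:: k4; 1; k0; k4; 1; k0]%N i.
Let side i := edge_from (p i) (slope i) (width i).
Hypotheses (s0 : s <> 0) (s4 : s <> 4).
Hypotheses (N3 : N 3 = - N 0) (N6 : N 6 = N 0).
Hypothesis det_gt0 : forall i, (i < 7)%N -> 0 < det2 (N i) (N i.+1).
Hypothesis supp_le :
  forall i x, (i < 8)%N -> coef2 A x != 0 -> dot (N i) x <= c i.
Hypothesis corner : forall i, (i < 7)%N ->
  [/\ coef2 A (V i) != 0, dot (N i) (V i) = c i & dot (N i.+1) (V i) = c i.+1].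
Hypothesis side_corners : forall i, (i < 6)%N ->
  side i = (V i, V i.+1) \/ side i = (V i.+1, V i).

Lemma three_slopes_edges e : is_edge R A e <->
  exists2 i, (i < 6)%N & (0 < width i)%N /\ e = side i.
Proof.
rewrite (hexagon_edges A N V c) //; split=> [[l [i i6 he]]|[i i6 [w0 ->]]].
  have h := side_corners i i6; exists i => //.
  have [w0|w0] := posnP (width i).
    have hs : (side i).1 = (side i).2.
      by rewrite /side w0 /edge_from /= mulr0 !addr0; case: (p i).
    have e1 : e.1 = e.2 by case: h hs he => -> /= -> [] ->.
    by rewrite e1 in l; case: (left_of_asym _ _ l l).
  split=> //; have /edge_from_left_of l' := w0.
  have {}l' := l' (p i) (slope i).
  by case: h l' he l => hs; rewrite -/(side i) hs => /= l' [] -> //= l;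
    case: (left_of_asym _ _ l l').
split; first exact/edge_from_left_of.
by exists i => //; apply: side_corners.
Qed.

Lemma three_slopes e :
  is_edge R A e -> [\/ has_slope e 0, has_slope e s | has_slope e 4].
Proof.
case/three_slopes_edges => i i6 [w0 ->].
have h : has_slope (side i) (slope i) by apply/edge_from_slope.
by case: i i6 w0 h => [|[|[|[|[|[|//]]]]]] _ _ h;
  solve [constructor 1; exact: h | constructor 2; exact: h
        | constructor 3; exact: h].
Qed.

Lemma edges_of_slope a e : is_edge R A e /\ has_slope e a <->
  exists2 i, (i < 6)%N & [/\ (0 < width i)%N, slope i = a & e = side i].
Proof.
split=> [[/three_slopes_edges[i i6 [w0 ->]] /(edge_from_slope _ _ _ _ w0) sa]|].
  by exists i; rewrite ?sa.
move=> [i i6 [w0 sa ->]]; split; last exact/edge_from_slope.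
by apply/three_slopes_edges; exists i.
Qed.

Lemma edges_of_slope_s e : is_edge R A e /\ has_slope e s <->
  e = edge_from (p 1) s 1 \/ e = edge_from (p 4) s 1.
Proof.
rewrite edges_of_slope; split=> [[i i6 [_ si ->]]|[]->]; last 2 first.
- by exists 1.
- by exists 4.
case: i i6 si => [|[|[|[|[|[|//]]]]]] _ si; rewrite /side /=;
  by [left | right | case: s4 | case: s0].
Qed.

Lemma edges_of_slope4 e : is_edge R A e /\ has_slope e 4 <->
  (0 < k4)%N /\ (e = edge_from (p 0) 4 k4 \/ e = edge_from (p 3) 4 k4).
Proof.
rewrite edges_of_slope; split=> [[i i6 [w0 si ->]]|[w0 []->]]; last 2 first.
- by exists 0.
- by exists 3.
by case: i i6 w0 si => [|[|[|[|[|[|//]]]]]] _ w0 si; split=> //; rewrite /side /=;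
  by [left | right | case: s4].
Qed.

End ThreeSlopes.

(** * The hexagon for n > 0 *)

Section PositiveEdges.
Context {R : realType} (n' : nat).
Local Notation n := n'.+1.
Local Notation A := (twist_poly (Posz n) L M).

Definition pos_normal i : int * int := nth 0
  [:: (0, -1); (4, -1); (4 * n%:Z, 1); (0, 1); (-4, 1); (- (4 * n%:Z), -1);
      (0, -1); (4, -1)] i.

Definition pos_corner i : int * int := nth 0
  [:: (n%:Z, 0); (2 * n%:Z, 4 * n%:Z); (2 * n%:Z - 1, 8 * n%:Z);
      (n%:Z, 8 * n%:Z); (0, 4 * n%:Z); (1, 0); (n%:Z, 0)] i.

Definition pos_max i : int := nth 0
  [:: 0; 4 * n%:Z; 4 * n%:Z * (2 * n%:Z) + 4 * n%:Z; 8 * n%:Z; 4 * n%:Z;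
      - (4 * n%:Z); 0; 4 * n%:Z] i.

Lemma coef2_pos_corner : [/\ coef2 A (pos_corner 0) = - (-1) ^+ n,
  coef2 A (pos_corner 1) = -1, coef2 A (pos_corner 2) = 1,
  coef2 A (pos_corner 3) = (-1) ^+ n' & coef2 A (pos_corner 4) = -1 /\
  coef2 A (pos_corner 5) = 1].
Proof.
split; last split.
- rewrite (coef2_edge_form _ _ _ _ _ _ _ _ 0 _ (pos_lower_right n)).
  + by rewrite coef_subX1_exp0 mulN1r.
  + by rewrite /dot /=; lia.
  + by congr (_, _); lia.
- rewrite (coef2_edge_form _ _ _ _ _ _ _ _ n _ (pos_lower_right n)).
  + by rewrite coef_subX1_exp_max.
  + by rewrite /dot /=; lia.
  + by congr (_, _); lia.
- rewrite (coef2_edge_form _ _ _ _ _ _ _ _ n' _ (pos_top n')).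
  + by rewrite coef_subX1_exp_max.
  + by rewrite /dot /=; lia.
  + by congr (_, _); lia.
- rewrite (coef2_edge_form _ _ _ _ _ _ _ _ 0 _ (pos_top n')).
  + by rewrite coef_subX1_exp0 mul1r.
  + by rewrite /dot /=; lia.
  + by congr (_, _); lia.
- rewrite (coef2_edge_form _ _ _ _ _ _ _ _ 0 _ (pos_upper_left n)).
  + by rewrite coef_subX1_exp0 exprS -mulrA -expr2 sqrr_sign mulr1.
  + by rewrite /dot /=; lia.
  + by congr (_, _); lia.
- rewrite (coef2_edge_form _ _ _ _ _ _ _ _ 0 _ (pos_bottom n')).
  + by rewrite coef_subX1_exp0 -expr2 sqrr_sign.
  + by rewrite /dot /=; lia.
  + by congr (_, _); lia.
Qed.

Lemma pos_support i p : (i < 8)%N -> coef2 A p != 0 ->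
  dot (pos_normal i) p <= pos_max i.
Proof.
move=> i8 nz.
have h1 := coef2_le _ _ _ _ _ (pos_upper_left n) nz.
have h2 := coef2_le _ _ _ _ _ (pos_lower_right n) nz.
have h3 := coef2_le _ _ _ _ _ (pos_top n') nz.
have h4 := coef2_le _ _ _ _ _ (pos_bottom n') nz.
have h5 := coef2_le _ _ _ _ _ (pos_left n) nz.
have h6 := coef2_le _ _ _ _ _ (pos_right n) nz.
have h7 := coef2_vertex _ _ _ _ _ _ _ _ (pos_left n) nz.
have h8 := coef2_vertex _ _ _ _ _ _ _ _ (pos_right n) nz.
case: p {nz} h1 h2 h3 h4 h5 h6 h7 h8 => b a; rewrite /dot /=.
move=> h1 h2 h3 h4 h5 h6 h7 h8.
case: i i8 => [|[|[|[|[|[|[|[|//]]]]]]]] _; rewrite /pos_normal /pos_max /=.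
- lia.
- lia.
(* The last column is the single point (2n, 4n). In the others the normal splits as (4n, 0) + (0,
   1), bounded by b <= 2n - 1 and a <= 8n. *)
- have [e|b2n] : b = 2 * n%:Z \/ b <= 2 * n%:Z - 1 by lia.
    by rewrite e in h8 *; rewrite h8; lia.
  have : 4 * n%:Z * b <= 4 * n%:Z * (2 * n%:Z - 1) by rewrite ler_wpM2l.
  by lia.
- lia.
- lia.
(* Symmetrically, the first column is the point (0, 4n), and b >= 1 with a >= 0 suffices
   elsewhere. *)
- have [e|b0] : b = 0 \/ 1 <= b by lia.
    by rewrite e in h7 *; rewrite h7; lia.
  have : 4 * n%:Z * 1 <= 4 * n%:Z * b by rewrite ler_wpM2l.
  by lia.
- lia.
- lia.
Qed.

Definition pos_start i : int * int := nth 0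
  [:: (n%:Z, 0); (2 * n%:Z - 1, 8 * n%:Z); (n%:Z, 8 * n%:Z); (0, 4 * n%:Z);
      (0, 4 * n%:Z); (1, 0)] i.

Lemma pos_det i : (i < 7)%N -> 0 < det2 (pos_normal i) (pos_normal i.+1).
Proof.
by case: i => [|[|[|[|[|[|[|//]]]]]]] _; rewrite /det2 /pos_normal /=; lia.
Qed.

Lemma pos_corner_max i : (i < 7)%N ->
  [/\ coef2 A (pos_corner i) != 0,
      dot (pos_normal i) (pos_corner i) = pos_max i
    & dot (pos_normal i.+1) (pos_corner i) = pos_max i.+1].
Proof.
have [c0 c1 c2 c3 [c4 c5]] := coef2_pos_corner.
case: i => [|[|[|[|[|[|[|//]]]]]]] _; split;
  try by rewrite /dot /pos_max /pos_normal /pos_corner /=; lia.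
- by rewrite c0 oppr_eq0 signr_eq0.
- by rewrite c1.
- by rewrite c2.
- by rewrite c3 signr_eq0.
- by rewrite c4.
- by rewrite c5.
- by rewrite [coef2 _ _]c0 oppr_eq0 signr_eq0.
Qed.

Lemma pos_side i : (i < 6)%N ->
  let e := edge_from (pos_start i) (nth 0 [:: 4; - 4 * n%:Z; 0; 4; - 4 * n%:Z; 0] i)
    (nth 0%N [:: n; 1; n'; n; 1; n']%N i) in
  e = (pos_corner i, pos_corner i.+1) \/ e = (pos_corner i.+1, pos_corner i).
Proof.
case: i => [|[|[|[|[|[|//]]]]]] _; rewrite /edge_from /pos_start /pos_corner /=;
  [left | right | right | right | left | left];
  by congr (_, _); congr (_, _); lia.
Qed.

Lemma pos_edges_spec :
  [/\ forall e, is_edge R A e ->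
        [\/ has_slope e 0, has_slope e (- 4 * n%:Z) | has_slope e 4],
      edges_have_opposite_polys R A (- 4 * n%:Z) ('X - 1),
      ~~ odd n -> edges_have_poly R A 4 (- ('X - 1) ^+ n)
    & odd n -> edges_have_opposite_polys R A 4 (('X - 1) ^+ n)].
Proof.
have s0 : - 4 * n%:Z <> 0 by lia.
have s4 : - 4 * n%:Z <> 4 by lia.
have N3 : pos_normal 3 = - pos_normal 0 by [].
have N6 : pos_normal 6 = pos_normal 0 by [].
have all_slopes := three_slopes (R := R) _ _ _ _ _ _ _ N3 N6 pos_det pos_support
  pos_corner_max pos_side.
have slope_s := edges_of_slope_s (R := R) _ _ _ _ _ _ _ s0 s4 N3 N6 pos_det
  pos_support pos_corner_max pos_side.
have slope4 := edges_of_slope4 (R := R) _ _ _ _ _ _ _ s4 N3 N6 pos_det pos_support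
  pos_corner_max pos_side.
have lower : edge_poly A (edge_from (pos_start 0) 4 n) = - ('X - 1) ^+ n.
  rewrite (edge_poly_edge_from _ _ _ 1 n 0 4 n _ (pos_lower_right n)) ?expr1 //.
  - by rewrite mulN1r.
  - by rewrite /dot /=; lia.
have upper : edge_poly A (edge_from (pos_start 3) 4 n) =
    (-1) ^+ n.+1 * ('X - 1) ^+ n.
  rewrite (edge_poly_edge_from _ _ _ n.+1 0 (4 * n) 4 n _ (pos_upper_left n)) //.
  by rewrite /dot /=; lia.
have [c0 c1 c2 c3 [c4 c5]] := coef2_pos_corner.
split=> //.
(* These sides have width 1, so only corner coefficients enter: -1, 1 on the left side and 1, -1 on
   the right one. *)
- exists (edge_from (pos_start 4) (- 4 * n%:Z) 1).
  exists (edge_from (pos_start 1) (- 4 * n%:Z) 1); split.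
  + by case; lia.
  + by move=> e; rewrite slope_s; split=> -[]; auto.
  + rewrite edge_poly_length1.
    have -> : coef2 A (pos_start 4) = -1 by [].
    have -> : ((pos_start 4).1 + 1, (pos_start 4).2 + - 4 * n%:Z) = pos_corner 5.
      by rewrite /pos_start /pos_corner /=; congr (_, _); lia.
    by rewrite c5 polyCN; ring.
  + rewrite edge_poly_length1.
    have -> : coef2 A (pos_start 1) = 1 by [].
    have -> : ((pos_start 1).1 + 1, (pos_start 1).2 + - 4 * n%:Z) = pos_corner 1.
      by rewrite /pos_start /pos_corner /=; congr (_, _); lia.
    by rewrite c1 polyCN; ring.
(* The upper sign is (-1)^(n+1), the lower one -1; they agree exactly when n is even. *)
- move=> n_even e he hs; have [_ [->|->]] := (slope4 e).1 (conj he hs).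
  + exact: lower.
  + by rewrite upper -signr_odd /= n_even mulN1r.
- move=> n_odd; exists (edge_from (pos_start 3) 4 n).
  exists (edge_from (pos_start 0) 4 n); split.
  + by case; lia.
  + by move=> e; rewrite slope4; split=> [[_ []]|[]]; auto.
  + by rewrite upper -signr_odd -[odd n.+1]/(~~ odd n) n_odd mul1r.
  + exact: lower.
Qed.
End PositiveEdges.

(** * The hexagon for n < 0, with [n] standing for the absolute value minus 1 *)

Section NegativeEdges.
Context {R : realType} (n : nat).
Local Notation A := (twist_poly (Negz n) L M).
Local Notation s := (4 * n%:Z + 6).

Definition neg_normal i : int * int := nth 0
  [:: (0, -1); (4, -1); (s, -1); (0, 1); (-4, 1); (- s, 1); (0, -1); (4, -1)] i.

Definition neg_corner i : int * int := nth 0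
  [:: (n%:Z, 0); (2 * n%:Z, 4 * n%:Z); (2 * n%:Z + 1, 8 * n%:Z + 6);
      (n%:Z + 1, 8 * n%:Z + 6); (1, s); (0, 0); (n%:Z, 0)] i.

Definition neg_max i : int := nth 0
  [:: 0; 4 * n%:Z; s * (2 * n%:Z) - 4 * n%:Z; 8 * n%:Z + 6; 4 * n%:Z + 2; 0; 0;
      4 * n%:Z] i.

Definition neg_start i : int * int := nth 0
  [:: (n%:Z, 0); (2 * n%:Z, 4 * n%:Z); (n%:Z + 1, 8 * n%:Z + 6); (1, s); (0, 0);
      (0, 0)] i.

Lemma coef2_neg_corner : [/\ coef2 A (neg_corner 0) = (-1) ^+ n,
  coef2 A (neg_corner 1) = 1, coef2 A (neg_corner 2) = 1,
  coef2 A (neg_corner 3) = (-1) ^+ n & coef2 A (neg_corner 4) = 1 /\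
  coef2 A (neg_corner 5) = 1].
Proof.
split; last split.
- rewrite (coef2_edge_form _ _ _ _ _ _ _ _ 0 _ (neg_lower_right n)).
  + by rewrite coef_subX1_exp0 mul1r.
  + by rewrite /dot /=; lia.
  + by congr (_, _); lia.
- rewrite (coef2_edge_form _ _ _ _ _ _ _ _ n _ (neg_lower_right n)).
  + by rewrite coef_subX1_exp_max.
  + by rewrite /dot /=; lia.
  + by congr (_, _); lia.
- rewrite (coef2_edge_form _ _ _ _ _ _ _ _ n _ (neg_top n)).
  + by rewrite coef_subX1_exp_max.
  + by rewrite /dot /=; lia.
  + by congr (_, _); lia.
- rewrite (coef2_edge_form _ _ _ _ _ _ _ _ 0 _ (neg_top n)).
  + by rewrite coef_subX1_exp0 mul1r.
  + by rewrite /dot /=; lia.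
  + by congr (_, _); lia.
- rewrite (coef2_edge_form _ _ _ _ _ _ _ _ 0 _ (neg_upper_left n)).
  + by rewrite coef_subX1_exp0 -expr2 sqrr_sign.
  + by rewrite /dot /=; lia.
  + by congr (_, _); lia.
- rewrite (coef2_edge_form _ _ _ _ _ _ _ _ 0 _ (neg_bottom n)).
  + by rewrite coef_subX1_exp0 -expr2 sqrr_sign.
  + by rewrite /dot /=; lia.
  + by congr (_, _); lia.
Qed.

Lemma neg_support i p : (i < 8)%N -> coef2 A p != 0 ->
  dot (neg_normal i) p <= neg_max i.
Proof.
move=> i8 nz.
have h1 := coef2_le _ _ _ _ _ (neg_upper_left n) nz.
have h2 := coef2_le _ _ _ _ _ (neg_lower_right n) nz.
have h3 := coef2_le _ _ _ _ _ (neg_top n) nz.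
have h4 := coef2_le _ _ _ _ _ (neg_bottom n) nz.
have h5 := coef2_le _ _ _ _ _ (neg_left n) nz.
have h6 := coef2_le _ _ _ _ _ (neg_right n) nz.
have h7 := coef2_vertex _ _ _ _ _ _ _ _ (neg_left n) nz.
have h8 := coef2_vertex _ _ _ _ _ _ _ _ (neg_right n) nz.
case: p {nz} h1 h2 h3 h4 h5 h6 h7 h8 => b a; rewrite /dot /=.
move=> h1 h2 h3 h4 h5 h6 h7 h8.
case: i i8 => [|[|[|[|[|[|[|[|//]]]]]]]] _; rewrite /neg_normal /neg_max /=.
- lia.
- lia.
(* Outside the last column the normal splits as (4n + 2, 0) + (4, -1): here the neighbouring bound
   is that of a side of slope 4, not of a horizontal one. *)
- have [e|b2n] : b = 2 * n%:Z + 1 \/ b <= 2 * n%:Z by lia.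
    by rewrite e in h8 *; rewrite h8; lia.
  have : (4 * n%:Z + 2) * b <= (4 * n%:Z + 2) * (2 * n%:Z) by rewrite ler_wpM2l.
  by lia.
- lia.
- lia.
(* Likewise (- s, 1) = (- (4n + 2), 0) + (-4, 1) once b >= 1; the column b = 0 is the origin
   alone. *)
- have [e|b0] : b = 0 \/ 1 <= b by lia.
    by rewrite e in h7 *; rewrite h7; lia.
  have : (4 * n%:Z + 2) * 1 <= (4 * n%:Z + 2) * b by rewrite ler_wpM2l.
  by lia.
- lia.
- lia.
Qed.

Lemma neg_det i : (i < 7)%N -> 0 < det2 (neg_normal i) (neg_normal i.+1).
Proof.
by case: i => [|[|[|[|[|[|[|//]]]]]]] _; rewrite /det2 /neg_normal /=; lia.
Qed.

Lemma neg_corner_max i : (i < 7)%N ->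
  [/\ coef2 A (neg_corner i) != 0,
      dot (neg_normal i) (neg_corner i) = neg_max i
    & dot (neg_normal i.+1) (neg_corner i) = neg_max i.+1].
Proof.
have [c0 c1 c2 c3 [c4 c5]] := coef2_neg_corner.
case: i => [|[|[|[|[|[|[|//]]]]]]] _; split;
  try by rewrite /dot /neg_max /neg_normal /neg_corner /=; lia.
- by rewrite c0 signr_eq0.
- by rewrite c1.
- by rewrite c2.
- by rewrite c3 signr_eq0.
- by rewrite c4.
- by rewrite c5.
- by rewrite [coef2 _ _]c0 signr_eq0.
Qed.

Lemma neg_side i : (i < 6)%N ->
  let e := edge_from (neg_start i) (nth 0 [:: 4; s; 0; 4; s; 0] i)
    (nth 0%N [:: n; 1; n; n; 1; n]%N i) in
  e = (neg_corner i, neg_corner i.+1) \/ e = (neg_corner i.+1, neg_corner i).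
Proof.
case: i => [|[|[|[|[|[|//]]]]]] _; rewrite /edge_from /neg_start /neg_corner /=;
  [left | left | right | right | right | left];
  by congr (_, _); congr (_, _); lia.
Qed.

Lemma neg_edges_spec :
  [/\ forall e, is_edge R A e ->
        [\/ has_slope e 0, has_slope e s | has_slope e 4],
      edges_have_poly R A s ('X + 1),
      odd n -> edges_have_opposite_polys R A 4 (('X - 1) ^+ n)
    & ~~ odd n -> edges_have_poly R A 4 (('X - 1) ^+ n)].
Proof.
have s0 : s <> 0 by lia.
have s4 : s <> 4 by lia.
have N3 : neg_normal 3 = - neg_normal 0 by [].
have N6 : neg_normal 6 = neg_normal 0 by [].
have all_slopes := three_slopes (R := R) _ _ _ _ _ _ _ N3 N6 neg_det neg_support
  neg_corner_max neg_side.
have slope_s := edges_of_slope_s (R := R) _ _ _ _ _ _ _ s0 s4 N3 N6 neg_det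
  neg_support neg_corner_max neg_side.
have slope4 := edges_of_slope4 (R := R) _ _ _ _ _ _ _ s4 N3 N6 neg_det neg_support
  neg_corner_max neg_side.
have lower : (0 < n)%N ->
    edge_poly A (edge_from (neg_start 0) 4 n) = ('X - 1) ^+ n.
  move=> n0; rewrite (edge_poly_edge_from _ _ _ 0 n 0 4 n _ (neg_lower_right n)) //.
  - by rewrite mul1r.
  - by rewrite /dot /=; lia.
have upper : (0 < n)%N -> edge_poly A (edge_from (neg_start 3) 4 n) =
    (-1) ^+ n * ('X - 1) ^+ n.
  move=> n0.
  rewrite (edge_poly_edge_from _ _ _ n 1 (4 * n + 6) 4 n _ (neg_upper_left n)) //.
  by rewrite /dot /=; lia.
have [c0 c1 c2 c3 [c4 c5]] := coef2_neg_corner.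
split=> //.
(* At n = 0 the two sides are the same segment from (0, 0) to (1, 6), the whole polygon. *)
- move=> e he hs; case: ((slope_s e).1 (conj he hs)) => ->;
    rewrite edge_poly_length1.
  + have -> : coef2 A (neg_start 1) = 1 by [].
    have -> : ((neg_start 1).1 + 1, (neg_start 1).2 + s) = neg_corner 2.
      by rewrite /neg_start /neg_corner /=; congr (_, _); lia.
    by rewrite c2; ring.
  + have -> : coef2 A (neg_start 4) = 1 by [].
    have -> : ((neg_start 4).1 + 1, (neg_start 4).2 + s) = neg_corner 4.
      by rewrite /neg_start /neg_corner /=; congr (_, _); lia.
    by rewrite c4; ring.
- move=> n_odd; have n0 : (0 < n)%N by exact: odd_gt0.
  exists (edge_from (neg_start 0) 4 n), (edge_from (neg_start 3) 4 n); split.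
  + by case; lia.
  + by move=> e; rewrite slope4; split=> [[]|].
  + exact: lower.
  + by rewrite upper // -signr_odd n_odd mulN1r.
- move=> n_even e he hs; have [n0 [->|->]] := (slope4 e).1 (conj he hs).
  + exact: lower.
  + by rewrite upper // -signr_odd (negPf n_even) mul1r.
Qed.

End NegativeEdges.

Theorem theorem1p4 (R : realType) (n : int) (A : {poly {poly int}})
    (hn : n <> 0) (hA : is_A_polynomial R n A) :
  (0 < n ->
    [/\ forall e, is_edge R A e ->
          [\/ has_slope e 0, has_slope e (- 4 * n) | has_slope e 4],
        edges_have_opposite_polys R A (- 4 * n) ('X - 1),
        ~~ odd `|n| -> edges_have_poly R A 4 (- ('X - 1) ^+ `|n|)
      & odd `|n| -> edges_have_opposite_polys R A 4 (('X - 1) ^+ `|n|)]) /\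
  (n < 0 ->
    [/\ forall e, is_edge R A e ->
          [\/ has_slope e 0, has_slope e (- 4 * n + 2) | has_slope e 4],
        edges_have_poly R A (- 4 * n + 2) ('X + 1),
        ~~ odd `|n| ->
          edges_have_opposite_polys R A 4 (('X - 1) ^+ `|n|.-1)
      & odd `|n| -> edges_have_poly R A 4 (('X - 1) ^+ `|n|.-1)]).
Proof.
have {hA} := A_normalizedE _ _ hA.2; case: n hn => [[|n]|n] hn -> //.
- by split=> // _; apply: pos_edges_spec.
- split=> // _; have [h1 h2 h3 h4] := @neg_edges_spec R n.
  have -> : - 4 * Negz n + 2 = 4 * n%:Z + 6 by lia.
  (* The absolute value of [Negz n] is n + 1, so parities are exchanged. *)
  by split=> //= n_odd; apply: h3; rewrite -[odd n]negbK.
Qed.
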